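(* Let $\mathcal{T}$ be a weakly bilinear mapping theory in which every mapping space $\mathcal{T}(A,B)$ is Serre cofibrant. Then $\mathcal{T}$ admits a good $\infty$-distributor.
   Context: $\mathbf{Top}$ is a convenient category of topological spaces (e.g. compactly generated weakly Hausdorff spaces), $\mathbf{Top}_*$ its pointed version with basepoints denoted $0$. A $\mathbf{Top}_*$-category $\mathcal{C}$ is a category enriched in $\mathbf{Top}_*$ with respect to the smash product; equivalently composition $\mathcal{C}(B,C)\times\mathcal{C}(A,B)\to\mathcal{C}(A,C)$, $(x,y)\mapsto xy$, is continuous with $0y=0$ and $x0=0$. A space is Serre cofibrant if it is cofibrant in the Serre (Quillen) model structure on $\mathbf{Top}$, i.e. a retract of a cell complex. A $\mathbf{Top}_*$-category $\mathcal{T}$ is a mapping theory if it is small and has finite products. It is left linear if all mapping spaces $\mathcal{T}(A,B)$ are topological monoids (written additively, not assumed commutative) with the basepoint $0$ as identity, and $(x+x')y=xy+x'y$. A mapping theory is weakly bilinear if it is left linear and, for all objects $A,B,Z$, the map $(i_A^*,i_B^* )\colon\mathcal{T}(A\times B,Z)\to\mathcal{T}(A,Z)\times\mathcal{T}(B,Z)$ is a Serre fibration and a weak equivalence, where $i_A=(1_A,0)$ and $i_B=(0,1_B)$. With $I=[0,1]$, an $n$-cube in a space $Y$ is a map $I^n\to Y$. For a cube $u\colon I^m\to\mathcal{T}(A,B)$ and a morphism $x\in\mathcal{T}(X,A)$, $u\otimes x$ is the cube $t\mapsto u(t)x$. Let $\mathcal{T}$ be left linear. An $\infty$-distributor for $\mathcal{T}$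 is a sequence of collections $\varphi=(\varphi^0,\varphi^1,\varphi^2,\dots)$, where $\varphi^m$ assigns to all objects $X,A,B$ and all $a\in\mathcal{T}(A,B)$, $x_0,\dots,x_m\in\mathcal{T}(X,A)$ an $m$-cube $\varphi_a^{x_0,\dots,x_m}\colon I^m\to\mathcal{T}(X,B)$, continuous in the inputs (i.e. $\mathcal{T}(A,B)\times\mathcal{T}(X,A)^{m+1}\to\mathcal{T}(X,B)^{I^m}$ is continuous), such that $\varphi_a^x=ax$ and for all $m\ge1$, $1\le j\le m$: $$\varphi_a^{x_0,\dots,x_m}(t_1,\dots,t_m)=\begin{cases}\varphi_a^{x_0,\dots,x_{j-1}+x_j,\dots,x_m}(t_1,\dots,\widehat{t_j},\dots,t_m)&\text{if }t_j=0\\ \varphi_a^{x_0,\dots,x_{j-1}}(t_1,\dots,t_{j-1})+\varphi_a^{x_j,\dots,x_m}(t_{j+1},\dots,t_m)&\text{if }t_j=1.\end{cases}$$ An $\infty$-distributor is good if for every $n\ge0$: (Universality) for all $a\colon A\to B$ and $x_0,\dots,x_n\colon X\to A$, $\varphi_a^{x_0,\dots,x_n}=\varphi_a^{p_0,\dots,p_n}\otimes(x_0,\dots,x_n)$, where $p_0,\dots,p_n\colon A^{n+1}\to A$ are the projections; and (Wedge condition) for all $a\colon A\to B$, $x\colon X\to A$ and $0\le k\le n$, the cube $\varphi_a^{0,\dots,x,\dots,0}$ ($x$ in position $k$) is the constant $n$-cube at $ax$. *)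

(* Defs.v *)
From HB Require Import structures.
From mathcomp Require Import all_boot all_order all_algebra.
From mathcomp Require Import all_classical reals.
From mathcomp Require Import topology.

Set Implicit Arguments.
Unset Strict Implicit.
Unset Printing Implicit Defensive.

Import Order.TTheory GRing.Theory Num.Theory.
Import numFieldTopology.Exports.
Local Open Scope classical_set_scope.

(** The category Top is the category of compactly generated weakly Hausdorff
    (CGWH) spaces and continuous maps. *)

Section compactly_generated_spaces.
Variable X : topologicalType.

Definition k_open (U : set X) : Prop :=
  forall (K : topologicalType) (f : K -> X),
    compact [set: K] -> hausdorff_space K -> continuous f -> open (f @^-1` U).

Definition compactly_generated : Prop := forall U : set X, k_open U -> open U.

Definition weakly_hausdorff : Prop :=
  forall (K : topologicalType) (f : K -> X),
    compact [set: K] -> hausdorff_space K -> continuous f -> closed (range f).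

Definition cgwh : Prop := compactly_generated /\ weakly_hausdorff.

(** The k-ification: the same points, with the k-open sets as open sets. *)
Definition kify : Type := X.

HB.instance Definition _ := Choice.on kify.

Lemma k_openT : k_open [set: X].
Proof. by move=> K f _ _ _; rewrite preimage_setT; exact: openT. Qed.

Lemma k_openI : setI_closed k_open.
Proof.
move=> U V kU kV K f cK hK cf; rewrite preimage_setI.
by apply: openI; [exact: kU | exact: kV].
Qed.

Lemma k_open_bigU (I : Type) (F : I -> set X) :
  (forall i, k_open (F i)) -> k_open (\bigcup_i F i).
Proof.
move=> kF K f cK hK cf; rewrite preimage_bigcup.
by apply: bigcup_open => i _; exact: kF.
Qed.

HB.instance Definition _ :=
  isOpenTopological.Build kify k_openT k_openI k_open_bigU.

End compactly_generated_spaces.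

(** Products in Top: the k-ification of the usual product topology. *)
Definition kprod (X Y : topologicalType) : topologicalType :=
  kify (X * Y)%type.

Definition kprod_fam (J : Type) (X : J -> topologicalType) : topologicalType :=
  kify (prod_topology X).

(** Mapping spaces in Top out of a compact Hausdorff space [U]: the
    k-ification of the compact-open topology on continuous maps. *)
Definition co_map (U V : topologicalType) : Type := continuousType U V.

HB.instance Definition _ (U V : topologicalType) :=
  Topological.copy (co_map U V)
    (initial_topology (id : continuousType U V -> {compact-open, U -> V})).

Definition map_space (U V : topologicalType) : topologicalType :=
  kify (co_map U V).

Section cubes.
Variable R : realType.

Definition unitI : topologicalType := set_type `[0%R : R, 1%R].

Definition cube (n : nat) : topologicalType :=
  prod_topology (fun _ : 'I_n => unitI).

Definition bdry (n : nat) : set (cube n) :=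
  [set t | exists i : 'I_n, \val (t i) = 0%R \/ \val (t i) = 1%R].

(** [p] has the homotopy lifting property with respect to all cubes. *)
Definition serre_fibration (E B : topologicalType) (p : E -> B) : Prop :=
  continuous p /\
  forall (n : nat) (f : cube n -> E) (H : (cube n * unitI)%type -> B),
    continuous f -> continuous H ->
    (forall t (s : unitI), \val s = 0%R -> H (t, s) = p (f t)) ->
    exists G : (cube n * unitI)%type -> E,
      [/\ continuous G,
          forall t (s : unitI), \val s = 0%R -> G (t, s) = f t &
          forall t s, p (G (t, s)) = H (t, s)].

(** The maps [(I^n, bdry I^n) -> (X, x)] and their homotopies relative to the
    boundary: the classes are the elements of [pi_n (X, x)]; for [n = 0] they
    are the path components of [X]. *)
Definition sphere_at (X : topologicalType) (x : X) (n : nat) (u : cube n -> X)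
  : Prop := continuous u /\ forall t, bdry t -> u t = x.

Definition homotopic_rel_bdry (X : topologicalType) (n : nat)
    (u v : cube n -> X) : Prop :=
  exists H : (cube n * unitI)%type -> X,
    [/\ continuous H,
        forall t (s : unitI), \val s = 0%R -> H (t, s) = u t,
        forall t (s : unitI), \val s = 1%R -> H (t, s) = v t &
        forall t s, bdry t -> H (t, s) = u t].

Definition pi_injective (X Y : topologicalType) (f : X -> Y) (n : nat) (x : X)
  : Prop :=
  forall u v : cube n -> X, sphere_at x u -> sphere_at x v ->
    homotopic_rel_bdry (f \o u) (f \o v) -> homotopic_rel_bdry u v.

Definition pi_surjective (X Y : topologicalType) (f : X -> Y) (n : nat) (x : X)
  : Prop :=
  forall v : cube n -> Y, sphere_at (f x) v ->
    exists u : cube n -> X, sphere_at x u /\ homotopic_rel_bdry (f \o u) v.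

(** The clause on inhabitants is surjectivity on path components when [X] is
    empty, where there is no base point to quantify over. *)
Definition weak_equivalence (X Y : topologicalType) (f : X -> Y) : Prop :=
  [/\ continuous f, inhabited Y -> inhabited X &
      forall (n : nat) (x : X), pi_injective f n x /\ pi_surjective f n x].

(** [Y] is obtained from [X] by attaching a family of cells, i.e. it is the
    pushout in Top of a coproduct of inclusions of boundaries of cells.  The
    pair [(I^n, bdry I^n)] serves as the n-cell [(D^n, S^(n-1))]; the boundary
    of [I^0] is empty. *)
Definition cell_attachment (X Y : topologicalType) (i : X -> Y) : Prop :=
  exists (J : Type) (n : J -> nat)
         (att : forall j, set_type (@bdry (n j)) -> X)
         (chr : forall j, cube (n j) -> Y),
    [/\ continuous i,
        forall j, continuous (att j),
        forall j, continuous (chr j),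
        forall j s, chr j (\val s) = i (att j s) &
        forall (Z : topologicalType) (g : X -> Z)
               (h : forall j, cube (n j) -> Z),
          cgwh Z -> continuous g -> (forall j, continuous (h j)) ->
          (forall j s, h j (\val s) = g (att j s)) ->
          exists! k : Y -> Z,
            [/\ continuous k, k \o i = g & forall j, k \o chr j = h j]].

(** [X] is the colimit in Top of a sequence of cell attachments that starts
    with the empty space. *)
Definition cell_complex (X : topologicalType) : Prop :=
  cgwh X /\
  exists (S : nat -> topologicalType) (i : forall k, S k -> S k.+1)
         (c : forall k, S k -> X),
    [/\ forall k, cgwh (S k),
        ~ inhabited (S 0),
        forall k, cell_attachment (i k),
        forall k, continuous (c k) /\ c k.+1 \o i k = c k &
        forall (Z : topologicalType) (g : forall k, S k -> Z),
          cgwh Z -> (forall k, continuous (g k)) ->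
          (forall k, g k.+1 \o i k = g k) ->
          exists! u : X -> Z, continuous u /\ forall k, u \o c k = g k].

Definition serre_cofibrant (X : topologicalType) : Prop :=
  exists (C : topologicalType) (s : X -> C) (r : C -> X),
    [/\ cell_complex C, continuous s, continuous r & cancel s r].

End cubes.

(** A small category enriched in pointed CGWH spaces. *)
Record ptTopCat := PtTopCat {
  ob :> Type;
  mor : ob -> ob -> topologicalType;
  mor_cgwh : forall A B, cgwh (mor A B);
  mor0 : forall A B, mor A B;
  mor1 : forall A, mor A A;
  mcomp : forall A B C, mor B C -> mor A B -> mor A C;
  mcomp_continuous : forall A B C,
    continuous (fun p : kprod (mor B C) (mor A B) => mcomp p.1 p.2);
  mcompA : forall A B C D (x : mor C D) (y : mor B C) (z : mor A B),
    mcomp x (mcomp y z) = mcomp (mcomp x y) z;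
  mcomp1m : forall A B (x : mor A B), mcomp (mor1 B) x = x;
  mcompm1 : forall A B (x : mor A B), mcomp x (mor1 A) = x;
  mcomp0m : forall A B C (y : mor A B), mcomp (mor0 B C) y = mor0 A C;
  mcompm0 : forall A B C (x : mor B C), mcomp x (mor0 A B) = mor0 A C
}.

Arguments mor0 {p} A B.
Arguments mor1 {p} A.
Arguments mcomp {p A B C} x y.

(** A mapping theory, with chosen finite products.  Products are enriched:
    the bijection [mor X (mprod A) -> prod_i mor X (A i)] is a homeomorphism
    (continuity of its inverse is [mpair_continuous]; its own continuity
    follows from [mcomp_continuous]). *)
Record mappingTheory := MappingTheory {
  mt_cat :> ptTopCat;
  mprod : forall J : finType, (J -> mt_cat) -> mt_cat;
  mproj : forall (J : finType) (A : J -> mt_cat) (j : J),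
    mor (mprod A) (A j);
  mpair : forall (J : finType) (A : J -> mt_cat) (X : mt_cat),
    (forall j, mor X (A j)) -> mor X (mprod A);
  mpair_continuous : forall (J : finType) (A : J -> mt_cat) (X : mt_cat),
    continuous (@mpair J A X : kprod_fam (fun j => mor X (A j)) -> _);
  mproj_mpair : forall (J : finType) (A : J -> mt_cat) (X : mt_cat)
      (f : forall j, mor X (A j)) (j : J),
    mcomp (mproj A j) (mpair f) = f j;
  mpair_mproj : forall (J : finType) (A : J -> mt_cat) (X : mt_cat)
      (f : mor X (mprod A)),
    mpair (fun j => mcomp (mproj A j) f) = f
}.

Arguments mprod {m J} A.
Arguments mproj {m J} A j.
Arguments mpair {m J A X} f.

Record leftLinear (T : ptTopCat) := LeftLinear {
  madd : forall A B : T, mor A B -> mor A B -> mor A B;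
  madd_continuous : forall A B : T,
    continuous (fun p : kprod (mor A B) (mor A B) => madd p.1 p.2);
  maddA : forall (A B : T) (x y z : mor A B),
    madd x (madd y z) = madd (madd x y) z;
  madd0m : forall (A B : T) (x : mor A B), madd (mor0 A B) x = x;
  maddm0 : forall (A B : T) (x : mor A B), madd x (mor0 A B) = x;
  mcomp_addl : forall (A B C : T) (x x' : mor B C) (y : mor A B),
    mcomp (madd x x') y = madd (mcomp x y) (mcomp x' y)
}.

Section weakly_bilinear.
Variables (R : realType) (T : mappingTheory).

Definition bfam (A B : T) (b : bool) : T := if b then A else B.

Definition bprod (A B : T) : T := mprod (bfam A B).

Definition bpair (X A B : T) (f : mor X A) (g : mor X B) : mor X (bprod A B) :=
  mpair (fun b => if b as b0 return mor X (bfam A B b0) then f else g).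

Definition incl1 (A B : T) : mor A (bprod A B) := bpair (mor1 A) (mor0 A B).

Definition incl2 (A B : T) : mor B (bprod A B) := bpair (mor0 B A) (mor1 B).

Definition restr (A B Z : T) (f : mor (bprod A B) Z) :
    kprod (mor A Z) (mor B Z) :=
  (mcomp f (incl1 A B), mcomp f (incl2 A B)).

Definition weakly_bilinear (L : leftLinear T) : Prop :=
  forall A B Z : T,
    serre_fibration R (@restr A B Z) /\ weak_equivalence R (@restr A B Z).

End weakly_bilinear.

Section distributors.
Variable R : realType.

(** In 0-based indexing, [merge_args i x] is
    [x_0, ..., x_i + x_(i+1), ..., x_(n+1)]. *)
Definition merge_args (T : ptTopCat) (L : leftLinear T) (X A : T) (n : nat)
    (i : 'I_n.+1) (x : 'I_n.+2 -> mor X A) : 'I_n.+1 -> mor X A :=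
  fun l => if l == i then madd L (x (inord i)) (x (inord i.+1))
           else x (lift (lift ord0 i) l).

(** In the face conditions [m = n.+1] and [j = i.+1]; each [inord] below has
    its argument within range. *)
Record distributor (T : ptTopCat) (L : leftLinear T) := Distributor {
  dist :> forall (n : nat) (X A B : T),
    mor A B -> ('I_n.+1 -> mor X A) -> continuousType (cube R n) (mor X B);
  dist_continuous : forall (n : nat) (X A B : T),
    continuous
      (fun p : kprod (mor A B) (kprod_fam (fun _ : 'I_n.+1 => mor X A)) =>
         dist p.1 p.2 : map_space (cube R n) (mor X B));
  dist0 : forall (X A B : T) (a : mor A B) (x : 'I_1 -> mor X A) (t : cube R 0),
    dist a x t = mcomp a (x ord0);
  dist_face0 : forall (n : nat) (X A B : T) (a : mor A B)
      (x : 'I_n.+2 -> mor X A) (i : 'I_n.+1) (t : cube R n.+1),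
    \val (t i) = 0%R ->
    dist a x t = dist a (merge_args L i x) (fun l : 'I_n => t (lift i l));
  dist_face1 : forall (n : nat) (X A B : T) (a : mor A B)
      (x : 'I_n.+2 -> mor X A) (i : 'I_n.+1) (t : cube R n.+1),
    \val (t i) = 1%R ->
    dist a x t =
      madd L
        (dist a (fun l : 'I_i.+1 => x (inord l))
                (fun l : 'I_i => t (inord l)))
        (dist a (fun l : 'I_(n - i).+1 => x (inord (i.+1 + l)))
                (fun l : 'I_(n - i) => t (inord (i.+1 + l))))
}.

Definition cube_tensor (T : ptTopCat) (n : nat) (X A B : T)
    (u : cube R n -> mor A B) (x : mor X A) : cube R n -> mor X B :=
  fun t => mcomp (u t) x.

Variables (T : mappingTheory) (L : leftLinear T) (phi : distributor L).

Definition universality (n : nat) : Prop :=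
  forall (X A B : T) (a : mor A B) (x : 'I_n.+1 -> mor X A),
    (phi n X A B a x : cube R n -> mor X B) =
    cube_tensor (phi n _ A B a (mproj (fun _ : 'I_n.+1 => A))) (mpair x).

Definition wedge_condition (n : nat) : Prop :=
  forall (X A B : T) (a : mor A B) (x : mor X A) (k : 'I_n.+1),
    (phi n X A B a (fun l => if l == k then x else mor0 X A)
      : cube R n -> mor X B) = cst (mcomp a x).

Definition good_distributor : Prop :=
  forall n : nat, universality n /\ wedge_condition n.

End distributors.

(* Main.v *)
From HB Require Import structures.
Require Import Defs.
From mathcomp Require Import all_boot all_order all_algebra.
From mathcomp Require Import all_classical reals topology normedtype.
From mathcomp Require Import ring lra zify.

(* By universality the n-cubes of a good distributor are determined by maps
   Phi_n : T(A,B) x I^n -> T(A^(n+1),B), which are built by induction on n.  The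
   face conditions prescribe Phi_n on T(A,B) x bdry I^n (the values agree on
   intersections of faces because the merges of arguments satisfy simplicial
   identities and + is associative), and the wedge condition prescribes the
   restrictions of Phi_n to the n+1 axes A -> A^(n+1).  So Phi_n is a lift of
   T(A,B) x bdry I^n -> T(A,B) x I^n against T(A^(n+1),B) -> T(A,B)^(n+1), which is
   a trivial Serre fibration by weak bilinearity at the pairs (A, A^k).

   Such lifts exist since T(A,B) is cofibrant: extend over the cells one at a
   time, passing to maps into the mapping space of I^n in order to use the
   universal properties of attachments and colimits; each cell leaves a lifting
   problem against bdry I^(m+n) -> I^(m+n).  The latter is solved by deforming it:
   first so that the partial lift becomes constant except on the top face, where
   injectivity on homotopy groups extends it over the cube; then so that it is
   constant on the whole boundary, where surjectivity on homotopy groups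
   applies.  Deformations of lifting problems are lifted by filling boxes. *)

Set Implicit Arguments.
Unset Strict Implicit.
Unset Printing Implicit Defensive.

Import Order.TTheory GRing.Theory Num.Theory.
Import numFieldTopology.Exports numFieldNormedType.Exports.
Local Open Scope classical_set_scope.

(** * Compactly generated spaces and mapping spaces *)

Lemma continuous_pair (X Y Z : topologicalType) (f : X -> Y) (g : X -> Z) :
  continuous f -> continuous g -> continuous (fun x => (f x, g x)).
Proof. by move=> cf cg x; apply: cvg_pair; [exact: cf | exact: cg]. Qed.

Lemma continuous_fst (X Y : topologicalType) : continuous (@fst X Y).
Proof. by move=> x; exact: cvg_fst. Qed.

Lemma continuous_snd (X Y : topologicalType) : continuous (@snd X Y).
Proof. by move=> x; exact: cvg_snd. Qed.

Lemma continuous_id (X : topologicalType) : continuous (@id X).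
Proof. by move=> x; exact: cvg_id. Qed.

Lemma continuous_cst (X Y : topologicalType) (y : Y) :
  continuous (fun _ : X => y).
Proof. by move=> x; exact: cvg_cst. Qed.

Lemma continuous_compose (X Y Z : topologicalType) (g : Y -> Z) (f : X -> Y) :
  continuous g -> continuous f -> continuous (fun x => g (f x)).
Proof. by move=> cg cf x; apply: continuous_comp; [exact: cf | exact: cg]. Qed.

Lemma continuous_prod_topology (I : Type) (T : I -> topologicalType)
    (X : topologicalType) (f : X -> prod_topology T) :
  (forall i, continuous (fun x => f x i)) -> continuous f.
Proof.
move=> cf x; apply/cvg_sup => i.
by apply: (@continuous_comp_initial _ _ _ (fun g : forall i, T i => g i) f).
Qed.

Lemma continuous_coord (I : eqType) (T : I -> topologicalType) (i : I) :
  continuous (fun f : prod_topology T => f i).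
Proof. exact: (@proj_continuous I T i). Qed.

Lemma continuous_closed_preimage (X Y : topologicalType) (f : X -> Y) D :
  continuous f -> closed D -> closed (f @^-1` D).
Proof. by move=> /continuous_closedP; apply. Qed.

Lemma continuous_within_comp (X Y Z : topologicalType) (B : set X) (A : set Y)
    (f : Y -> Z) (r : X -> Y) :
  {within A, continuous f} -> continuous r -> (forall x, B x -> A (r x)) ->
  {within B, continuous (fun x => f (r x))}.
Proof.
move=> /subspace_continuousP cf cr rBA; apply/subspace_continuousP => x Bx.
move=> W /(cf _ (rBA _ Bx)); rewrite /within /= !nbhs_simpl /= => fW.
have := cr x _ fW; rewrite !nbhs_simpl /=; apply: filterS => y /= yW By.
exact/yW/rBA.
Qed.

Lemma continuous_withinT (X Y : topologicalType) (f : X -> Y) :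
  {within [set: X], continuous f} -> continuous f.
Proof. by move=> cf; apply/continuous_subspace_setT. Qed.

Lemma within_eq_continuous (X Y : topologicalType) (A : set X) (f g : X -> Y) :
  (forall x, A x -> f x = g x) -> {within A, continuous f} ->
  {within A, continuous g}.
Proof.
move=> fg cf; apply: (@subspace_eq_continuous _ A _ f g) => // x /set_mem.
exact: fg.
Qed.

Lemma withinU_eq_continuous (X Y : topologicalType) (A B : set X)
    (f g h : X -> Y) :
  closed A -> closed B -> {within A, continuous f} -> {within B, continuous g} ->
  (forall x, A x -> h x = f x) -> (forall x, B x -> h x = g x) ->
  {within A `|` B, continuous h}.
Proof.
move=> cA cB cf cg hf hg; apply: withinU_continuous => //.
- by apply: within_eq_continuous cf => x /hf.
- by apply: within_eq_continuous cg => x /hg.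
Qed.

Lemma within_bigcup_continuous (X Y : topologicalType) (I : finType)
    (A : I -> set X) (f : X -> Y) :
  (forall i, closed (A i)) -> (forall i, {within A i, continuous f}) ->
  {within \bigcup_i A i, continuous f}.
Proof.
move=> cA cf.
suff H (s : seq I) : closed (\bigcup_(i in [set` s]) A i) /\
    {within \bigcup_(i in [set` s]) A i, continuous f}.
  have -> : \bigcup_i A i = \bigcup_(i in [set` enum I]) A i.
    by apply: eq_bigcupl; split => i //= _; rewrite mem_enum.
  by case: (H (enum I)).
elim: s => [|i s [IHc IHf]].
  have -> : \bigcup_(i in [set` [::]]) A i = set0.
    by apply/seteqP; split => // x [].
  by split; [exact: closed0 | exact: continuous_subspace0].
have -> : \bigcup_(j in [set` i :: s]) A j =
    A i `|` \bigcup_(j in [set` s]) A j.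
  apply/seteqP; split => [x [j]|x [Aix|[j js Ajx]]] /=.
  - by rewrite inE => /orP[/eqP -> |js] Ajx; [left | right; exists j].
  - by exists i => //=; rewrite mem_head.
  - by exists j => //=; rewrite inE js orbT.
split; first exact: closedU.
exact: withinU_continuous.
Qed.

Section compactly_generated.

Lemma cg_continuous (X Y : topologicalType) (f : X -> Y) :
  compactly_generated X ->
  (forall (K : topologicalType) (g : K -> X), compact [set: K] ->
     hausdorff_space K -> continuous g -> continuous (fun k => f (g k))) ->
  continuous f.
Proof.
move=> cgX H; apply/continuousP => U oU; apply: cgX => K g cK hK cg.
by have /continuousP/(_ _ oU) := H K g cK hK cg.
Qed.

Lemma open_kifyE (X : topologicalType) (U : set X) :
  @open (kify X) U = k_open U.
Proof. by []. Qed.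

Lemma continuous_unkify (X : topologicalType) :
  continuous (fun x : kify X => x : X).
Proof.
apply/continuousP => U oU; rewrite open_kifyE => K f _ _ cf.
by move/continuousP: cf; apply.
Qed.

Lemma continuous_kify (X Y : topologicalType) (f : X -> Y) :
  compactly_generated X -> continuous f -> continuous (f : X -> kify Y).
Proof.
move=> cgX cf; apply/continuousP => U; rewrite open_kifyE => kU; apply: cgX => K g cK hK cg.
rewrite -comp_preimage; apply: kU => //.
exact: (continuous_compose cf cg).
Qed.

Lemma compact_hausdorff_cg (X : topologicalType) :
  compact [set: X] -> hausdorff_space X -> compactly_generated X.
Proof.
move=> cX hX U kU; rewrite -[U](preimage_id).
by apply: kU => //; exact: continuous_id.
Qed.

(** A compact Hausdorff space is compactly generated, so its maps into [X] are already continuous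
    into [kify X]. Hence both spaces have the same test maps. *)
Lemma kify_cg (X : topologicalType) : compactly_generated (kify X).
Proof.
move=> U kU; rewrite open_kifyE => K f cK hK cf; apply: kU => //.
by apply: continuous_kify => //; exact: compact_hausdorff_cg.
Qed.

Lemma continuous_kpair (X Y Z : topologicalType) (f : X -> Y) (g : X -> Z) :
  compactly_generated X -> continuous f -> continuous g ->
  continuous (fun x => (f x, g x) : kprod Y Z).
Proof.
by move=> cgX cf cg; apply: continuous_kify => //; exact: continuous_pair.
Qed.

Lemma continuous_kfst (X Y : topologicalType) :
  continuous (fun p : kprod X Y => p.1).
Proof. exact: (continuous_compose (@continuous_fst X Y) (@continuous_unkify _)). Qed.

Lemma continuous_ksnd (X Y : topologicalType) :
  continuous (fun p : kprod X Y => p.2).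
Proof. exact: (continuous_compose (@continuous_snd X Y) (@continuous_unkify _)). Qed.


Lemma continuous_set_val (X : topologicalType) (C : set X) :
  continuous (fun c : set_type C => \val c).
Proof. exact: (@initial_continuous (set_type C) X set_val). Qed.

Lemma continuous_into_set_type (X Y : topologicalType) (C : set X)
    (f : Y -> set_type C) :
  continuous (fun y => \val (f y)) -> continuous f.
Proof. exact: (@continuous_comp_initial (set_type C) Y X set_val f). Qed.

Lemma compact_set_type (X : topologicalType) (C : set X) :
  compact C -> compact [set: set_type C].
Proof.
move=> cC F FF _.
have [|p [Cp clp]] := cC (fmap (fun c : set_type C => \val c) F) _ _.
  apply: (@filterS _ F FF setT); last exact: filterT.
  by move=> [x xC] _; exact: set_mem.
exists (exist _ p (mem_set Cp)); split => // U V FU [_ [[W oW <-] Wp WV]].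
have FvU : F ((fun c : set_type C => \val c) @^-1` (\val @` U)).
  by apply: filterS FU => c Uc; exists c.
have [y [[c Uc <-] Wc]] := clp _ _ FvU (open_nbhs_nbhs (conj oW Wp)).
by exists c; split => //; exact: WV.
Qed.

Lemma hausdorff_set_type (X : topologicalType) (C : set X) :
  hausdorff_space X -> hausdorff_space (set_type C).
Proof.
move=> hX x y xy; apply/val_inj/hX => U V Ux Vy.
have [z [Uz Vz]] := xy _ _ (continuous_set_val Ux) (continuous_set_val Vy).
by exists (\val z).
Qed.

(** The point is the range of a constant map from a nonempty compact Hausdorff space, here
    [bool]. *)
Lemma wh_closed_set1 (X : topologicalType) (x : X) :
  weakly_hausdorff X -> closed [set x].
Proof.
move=> /(_ bool (fun=> x) bool_compact discrete_hausdorff (@continuous_cst _ _ x)).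
congr closed; apply/seteqP; split => [_ [_ _ <-] //|_ ->].
by exists true.
Qed.

Lemma wh_closed_image (K X : topologicalType) (f : K -> X) (C : set K) :
  compact [set: K] -> hausdorff_space K -> weakly_hausdorff X ->
  continuous f -> closed C -> closed (f @` C).
Proof.
move=> cK hK wX cf cC.
have <- : range (fun c : set_type C => f (\val c)) = f @` C.
  apply/seteqP; split => [_ [c _ <-]|_ [c Cc <-]].
    by exists (\val c) => //; apply: set_mem; case: c.
  by exists (exist _ c (mem_set Cc)).
apply: wX.
- exact/compact_set_type/(subclosed_compact cC cK).
- exact: hausdorff_set_type.
- exact: (continuous_compose cf (@continuous_set_val _ _)).
Qed.

(* [v] is a closed map, so disjoint neighbourhoods of two fibres of [v] in the
   normal space [L] descend to open sets of [X] that are disjoint on the image of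
   [v]. *)
Lemma wh_closed_equalizer (K L X : topologicalType) (u : K -> X) (v : L -> X) :
  compact [set: L] -> hausdorff_space L -> weakly_hausdorff X ->
  continuous u -> continuous v -> closed [set p : K * L | u p.1 = v p.2].
Proof.
move=> cL hL wX cu cv.
have nL : normal_space L := compact_normal hL cL.
have c1 y : closed (v @^-1` [set y]).
  by apply: continuous_closed_preimage => //; exact: wh_closed_set1.
rewrite -openC openE => -[k l] /= neq.
have snb : set_nbhs (v @^-1` [set u k]) (~` (v @^-1` [set v l])).
  apply/set_nbhsP; exists (~` (v @^-1` [set v l])).
  split => //; first exact/closed_openC/c1.
  by move=> z /= vz vl; apply: neq; rewrite -vz.
have [W /set_nbhsP[V [oV AV VW]] sW] := nL _ (c1 (u k)) _ snb.
have oimg C : closed C -> open (~` (v @` C)).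
  by move=> cC; apply: closed_openC; exact: wh_closed_image.
have nx : nbhs (u k) (~` (v @` (~` V))).
  apply: open_nbhs_nbhs; split; first exact/oimg/open_closedC.
  by move=> [z Vz vz]; apply: Vz; exact: AV.
have ny : nbhs (v l) (~` (v @` closure W)).
  apply: open_nbhs_nbhs; split; first exact/oimg/closed_closure.
  by move=> [z /sW Wz vz]; exact: Wz.
exists (u @^-1` (~` (v @` (~` V))), v @^-1` (~` (v @` closure W))) => /=.
  by split; [exact: cu | exact: cv].
move=> [k' l'] /= [Vk Wl] uv.
have [/VW/subset_closure cW|nV] := pselect (V l'); first by apply: Wl; exists l'.
by apply: Vk; exists l'.
Qed.

(** For a compact Hausdorff test map [g] into [Z], the preimage of the range of [f] is the
    projection to [L] of the set [D] of pairs with equal image. Joint injectivity writes [D] as an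
    intersection of equalizers in the [E i], so [D] is closed in a compact space and its projection
    is closed. *)
Lemma wh_jointly_injective (Z : topologicalType) (I : Type)
    (E : I -> topologicalType) (ev : forall i, Z -> E i) :
  (forall i, weakly_hausdorff (E i)) -> (forall i, continuous (ev i)) ->
  (forall a b, (forall i, ev i a = ev i b) -> a = b) ->
  weakly_hausdorff (kify Z).
Proof.
move=> wE cev evI K f cK hK cf; rewrite -openC open_kifyE => L g cL hL cg.
have cf' := continuous_compose (@continuous_unkify Z) cf.
pose D := [set p : L * K | forall i, ev i (g p.1) = ev i (f p.2)].
have cD : closed D.
  have -> : D = \bigcap_i [set p : L * K | ev i (g p.1) = ev i (f p.2)].
    by apply/seteqP; split => [p Dp i _|p Dp i]; [exact: Dp | exact: (Dp i)].
  apply: closed_bigI => i _; apply: (@wh_closed_equalizer L K (E i) (fun l => ev i (g l))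
    (fun k => ev i (f k)) cK hK (wE i)).
  - exact: (continuous_compose (cev i) cg).
  - exact: (continuous_compose (cev i) cf').
have cLK : compact [set: L * K] by rewrite -setXTT; exact: compact_setX.
have : closed (fst @` D).
  apply: compact_closed => //; apply: continuous_compact.
    by apply: continuous_subspaceT; exact: continuous_fst.
  exact: (subclosed_compact cD cLK).
rewrite -openC; congr open; rewrite -preimage_setC; congr (~` _).
apply/seteqP; split => [l [[l' k] Dl /= <-]|l [k _ kl]].
  by exists k => //; apply: evI => i; rewrite Dl.
by exists (l, k) => //= i; rewrite -kl.
Qed.

Lemma kify_cgwh (Z : topologicalType) (I : Type)
    (E : I -> topologicalType) (ev : forall i, Z -> E i) :
  (forall i, weakly_hausdorff (E i)) -> (forall i, continuous (ev i)) ->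
  (forall a b, (forall i, ev i a = ev i b) -> a = b) -> cgwh (kify Z).
Proof. by split; [exact: kify_cg | exact: (wh_jointly_injective (ev := ev))]. Qed.

End compactly_generated.

Section mapping_space.
Variables (U : topologicalType) (cU : compact [set: U]).
Hypothesis hU : hausdorff_space U.

Lemma compactT_locally_compact : locally_compact [set: U].
Proof.
move=> x _; rewrite withinET; exists [set: U]; first exact: filterT.
by split; [exact: cU | exact: closedT].
Qed.

Definition continuous_map (Y : topologicalType) (f : U -> Y)
    (cf : continuous f) : continuousType U Y :=
  HB.pack f (isContinuous.Build U Y f cf).

Lemma continuous_co_eval (X Y : topologicalType) (f : X -> co_map U Y) :
  continuous f -> continuous (fun p : X * U => f p.1 p.2).
Proof.
move=> cf.
have -> : (fun p : X * U => f p.1 p.2) = uncurry (fun x => f x : U -> Y).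
  by apply/funext => -[].
apply: (@continuous_uncurry X U Y (fun x => f x : U -> Y)) => //.
- exact: compactT_locally_compact.
- exact: (continuous_compose (@initial_continuous _ _ _) cf).
- by move=> x; exact: cts_fun.
Qed.

Lemma continuous_into_co_map (X Y : topologicalType) (f : X -> co_map U Y) :
  continuous (fun p : X * U => f p.1 p.2) -> continuous f.
Proof.
move=> cf; apply: continuous_comp_initial.
by have [] := @continuous_curry X U Y (fun p : X * U => f p.1 p.2).
Qed.

Lemma continuous_map_space_eval (X Y : topologicalType) (f : X -> map_space U Y) :
  continuous f -> continuous (fun p : X * U => f p.1 p.2).
Proof.
move=> cf; apply: (@continuous_co_eval X Y (fun x => f x : co_map U Y)).
exact: (continuous_compose (@continuous_unkify _) cf).
Qed.

Lemma continuous_into_map_space (X Y : topologicalType)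
    (f : X -> map_space U Y) :
  compactly_generated X ->
  continuous (fun p : X * U => f p.1 p.2) -> continuous f.
Proof.
move=> cgX cf; apply: continuous_kify => //.
exact: (@continuous_into_co_map X Y (fun x => f x : co_map U Y)).
Qed.

(** The evaluations at the points of [U] are jointly injective. *)
Lemma map_space_cgwh (Y : topologicalType) : cgwh Y -> cgwh (map_space U Y).
Proof.
move=> [_ wY]; apply: (@kify_cgwh (co_map U Y) U (fun _ => Y)
  (fun u (f : co_map U Y) => (f : continuousType U Y) u)) => //.
- move=> u; apply: (continuous_compose
    (@continuous_co_eval _ _ id (@continuous_id (co_map U Y)))
    (continuous_pair (@continuous_id _) (@continuous_cst _ _ u))).
- by move=> a b ab; apply/continuousEP.
Qed.

Lemma hausdorff_prod (X Y : topologicalType) :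
  hausdorff_space X -> hausdorff_space Y -> hausdorff_space (X * Y)%type.
Proof.
move=> hX hY [x y] [x' y'] xy; congr pair.
- apply: hX => A B Ax Bx; have [] := xy (fst @^-1` A) (fst @^-1` B).
  + exact: (@continuous_fst X Y (x, y)).
  + exact: (@continuous_fst X Y (x', y')).
  + by move=> z [Az Bz]; exists z.1.
- apply: hY => A B Ay By; have [] := xy (snd @^-1` A) (snd @^-1` B).
  + exact: (@continuous_snd X Y (x, y)).
  + exact: (@continuous_snd X Y (x', y')).
  + by move=> z [Az Bz]; exists z.2.
Qed.

Lemma compact_prodT (X Y : topologicalType) :
  compact [set: X] -> compact [set: Y] -> compact [set: X * Y].
Proof. by move=> cX cY; rewrite -setXTT; exact: compact_setX. Qed.

(* [K * U] is compact Hausdorff for every compact Hausdorff [K], so the identity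
   [X * U -> kify (X * U)] is continuous in each test map on [X]; as [U] is
   locally compact, currying turns this into joint continuity. *)
Lemma cg_prod (X : topologicalType) :
  compactly_generated X -> compactly_generated (X * U)%type.
Proof.
move=> cgX.
have cgU := compact_hausdorff_cg cU hU.
have csec (x : X) : continuous (fun u => (x, u) : kify (X * U)%type).
  apply: continuous_kify => //.
  exact: (continuous_pair (@continuous_cst _ _ x) (@continuous_id U)).
pose F x : co_map U (kify (X * U)%type) := continuous_map (csec x).
have cF : continuous F.
  apply: cg_continuous => // K g cK hK cg; apply: continuous_into_co_map => /=.
  apply: continuous_kify.
    by apply: compact_hausdorff_cg; [exact: compact_prodT | exact: hausdorff_prod].
  apply: continuous_pair; last exact: continuous_snd.
  exact: (continuous_compose cg (@continuous_fst K U)).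
have := continuous_co_eval cF.
have -> : (fun p : X * U => F p.1 p.2) = id by apply/funext => -[].
by move/continuousP => oid V kV; exact: (oid V).
Qed.

End mapping_space.
Arguments continuous_map {U Y f}.

(** * Cubes *)

Section lifting.

(** The partial lift [F] is a total function constrained on [A] only, which avoids maps out of
    subtypes. *)
Definition lifts (E B : topologicalType) (p : E -> B) (K : topologicalType)
    (A : set K) : Prop :=
  forall (F : K -> E) (g : K -> B), {within A, continuous F} -> continuous g ->
    (forall y, A y -> p (F y) = g y) ->
    exists L : K -> E,
      [/\ continuous L, forall y, A y -> L y = F y & forall y, p (L y) = g y].

End lifting.

(** * Continuity of real formulas *)

Section real_continuity.
Context {R : realType} {X : topologicalType}.
Implicit Types f g : X -> R.
Local Open Scope ring_scope.

Lemma contD f g : continuous f -> continuous g -> continuous (fun x => f x + g x).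
Proof. by move=> cf cg x; apply: cvgD; [exact: cf | exact: cg]. Qed.

Lemma contB f g : continuous f -> continuous g -> continuous (fun x => f x - g x).
Proof. by move=> cf cg x; apply: cvgB; [exact: cf | exact: cg]. Qed.

Lemma contM f g : continuous f -> continuous g -> continuous (fun x => f x * g x).
Proof. by move=> cf cg x; apply: cvgM; [exact: cf | exact: cg]. Qed.

Lemma contV f : (forall x, f x != 0) -> continuous f -> continuous (fun x => (f x)^-1).
Proof. by move=> f0 cf x; apply: cvgV => //; exact: cf. Qed.

Lemma cont_norm f : continuous f -> continuous (fun x => `|f x|).
Proof. by move=> cf x; apply: cvg_norm; exact: cf. Qed.

Lemma cont_max f g :
  continuous f -> continuous g -> continuous (fun x => Num.max (f x) (g x)).
Proof.
move=> cf cg; under eq_fun do rewrite maxr_absE.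
apply: contM; last exact: continuous_cst.
by apply: contD; [exact: contD | exact/cont_norm/contB].
Qed.

Lemma cont_min f g :
  continuous f -> continuous g -> continuous (fun x => Num.min (f x) (g x)).
Proof.
move=> cf cg; under eq_fun do rewrite minr_absE.
apply: contM; last exact: continuous_cst.
by apply: contB; [exact: contD | exact/cont_norm/contB].
Qed.

Lemma cont_bigmax (I : Type) (s : seq I) (F : I -> X -> R) :
  (forall i, continuous (F i)) ->
  continuous (fun x => \big[Num.max/0]_(i <- s) F i x).
Proof.
move=> cF; elim: s => [|i s IH].
  under eq_fun do rewrite big_nil; exact: continuous_cst.
by under eq_fun do rewrite big_cons; exact: cont_max.
Qed.

End real_continuity.

Section cubes.
Variable R : realType.
Local Open Scope ring_scope.
Local Notation I := (unitI R).
Local Notation cube := (cube R).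

Lemma unitI_bounds (x : I) : 0 <= \val x <= 1.
Proof. by case: x => x /= /set_mem; rewrite /= in_itv. Qed.

Lemma clamp_subproof (x : R) : {y : I | \val y = Num.max 0 (Num.min 1 x)}.
Proof.
have xI : Num.max 0 (Num.min 1 x) \in `[0%R : R, 1%R]%classic.
  by apply/mem_set; rewrite /= in_itv /= le_max lexx /= ge_max ler01 ge_min lexx.
by exists (exist (fun y : R => y \in `[0%R : R, 1%R]%classic) _ xI).
Qed.

(** Truncation lets maps into cubes be given by real formulas without range proofs; ranges are
    checked only where a value has to be known. *)
Definition clamp (x : R) : I := sval (clamp_subproof x).

Lemma clampE x : \val (clamp x) = Num.max 0 (Num.min 1 x).
Proof. exact: svalP (clamp_subproof x). Qed.

Lemma val_clamp x : 0 <= x <= 1 -> \val (clamp x) = x.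
Proof. by move=> /andP[x0 x1]; rewrite clampE (min_idPr x1) (max_idPr x0). Qed.

Lemma clampK (x : I) : clamp (\val x) = x.
Proof. by apply/val_inj/val_clamp/unitI_bounds. Qed.

Lemma clamp_le0 x : x <= 0 -> \val (clamp x) = 0.
Proof.
by move=> x0; rewrite clampE; apply/max_idPl; rewrite ge_min x0 orbT.
Qed.

Lemma clamp_ge1 x : 1 <= x -> \val (clamp x) = 1.
Proof. by move=> x1; rewrite clampE (min_idPl x1); apply/max_idPr. Qed.

Lemma continuous_clamp (X : topologicalType) (f : X -> R) :
  continuous f -> continuous (fun x => clamp (f x)).
Proof.
move=> cf; apply: continuous_into_set_type; under eq_fun do rewrite clampE.
apply: cont_max; first exact: continuous_cst.
by apply: cont_min => //; exact: continuous_cst.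
Qed.

Lemma continuous_unitI_val (X : topologicalType) (f : X -> I) :
  continuous f -> continuous (fun x => \val (f x)).
Proof. exact: (continuous_compose (@continuous_set_val _ _)). Qed.

Lemma unitI_compact : compact [set: I].
Proof. by apply: compact_set_type; exact: segment_compact. Qed.

Lemma unitI_hausdorff : hausdorff_space I.
Proof. by apply: hausdorff_set_type; exact: Rhausdorff. Qed.

Lemma cube_compact n : compact [set: cube n].
Proof.
have := @tychonoff 'I_n (fun=> I) (fun=> [set: I]) (fun=> unitI_compact).
by congr compact; apply/seteqP; split.
Qed.

Lemma cube_hausdorff n : hausdorff_space (cube n).
Proof. by apply: (@hausdorff_product 'I_n (fun=> I)) => _; exact: unitI_hausdorff. Qed.

Lemma cube_cg n : compactly_generated (cube n).
Proof. by apply: compact_hausdorff_cg; [exact: cube_compact | exact: cube_hausdorff]. Qed.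

Lemma continuous_cube_coord (X : topologicalType) n (f : X -> cube n) i :
  continuous f -> continuous (fun x => f x i).
Proof. exact: (continuous_compose (@continuous_coord _ _ i)). Qed.

Lemma closed_val_eq (X : topologicalType) (f : X -> I) (c : R) :
  continuous f -> closed [set x | \val (f x) = c].
Proof.
move=> cf; apply: (@continuous_closed_preimage X R (fun x => \val (f x)) [set c]).
  exact: continuous_unitI_val.
exact: (accessible_closed_set1 (hausdorff_accessible (@Rhausdorff R))).
Qed.

(** Twice the sup-norm distance to the centre, so that the boundary is the unit sphere. For [n = 0]
    the empty maximum 0 agrees with the boundary being empty. *)
Definition cube_rad n (t : cube n) : R :=
  \big[Num.max/0]_i `|2 * \val (t i) - 1|.

Lemma continuous_cube_rad (X : topologicalType) n (f : X -> cube n) :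
  continuous f -> continuous (fun x => cube_rad (f x)).
Proof.
move=> cf; apply: (@cont_bigmax R X _ _
  (fun i x => `|2 * \val (f x i) - 1|)) => i.
apply: cont_norm; apply: contB.
  apply: contM; first exact: continuous_cst.
  exact: (continuous_unitI_val (continuous_cube_coord cf)).
exact: continuous_cst.
Qed.

Lemma cube_rad_ub n (t : cube n) i : `|2 * \val (t i) - 1| <= cube_rad t.
Proof. by rewrite /cube_rad (bigD1 i) //= le_max lexx. Qed.

Lemma cube_rad_le1 n (t : cube n) : cube_rad t <= 1.
Proof.
rewrite /cube_rad; apply: (big_ind (fun x : R => x <= 1)) => // [x y x1 y1|i _].
  by rewrite ge_max x1.
by have := unitI_bounds (t i); rewrite ler_norml; lra.
Qed.

Lemma cube_rad_attained n (t : cube n) :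
  cube_rad t = 0 \/ exists i, cube_rad t = `|2 * \val (t i) - 1|.
Proof.
rewrite /cube_rad; apply: (big_ind (fun x : R => x = 0 \/
  exists i, x = `|2 * \val (t i) - 1|)) => [|x y xP yP|i _].
- by left.
- by rewrite maxEle; case: ifP.
- by right; exists i.
Qed.

Lemma bdry_norm n (t : cube n) : bdry t <-> exists i, `|2 * \val (t i) - 1| = 1.
Proof.
split => [[i ti]|[i]].
- exists i; case: ti => ->; first by rewrite mulr0 sub0r normrN1.
  by rewrite mulr1 [2](_ : _ = 1 + 1) ?addrK ?normr1.
- move/eqP; rewrite eqr_norml ler01 andbT => /orP[/eqP|/eqP] ti; exists i.
    by right; lra.
  by left; lra.
Qed.

Lemma bdry_cube_rad n (t : cube n) : bdry t <-> cube_rad t = 1.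
Proof.
rewrite bdry_norm; split => [[i ti]|r1].
  by apply/eqP; rewrite eq_le cube_rad_le1 -ti cube_rad_ub.
have [|[i]] := cube_rad_attained t; first by rewrite r1 => /eqP; rewrite oner_eq0.
by rewrite r1 => ti; exists i.
Qed.

Lemma closed_bdry n : closed (@bdry R n).
Proof.
have -> : @bdry R n = @cube_rad n @^-1` [set 1].
  by apply/seteqP; split => t /=; rewrite bdry_cube_rad.
apply: continuous_closed_preimage.
  exact: (@continuous_cube_rad _ n id (@continuous_id _)).
exact: (accessible_closed_set1 (hausdorff_accessible (@Rhausdorff R))).
Qed.

End cubes.

(** * Retraction onto the open box and box filling *)

Section boxes.
Variable R : realType.
Local Open Scope ring_scope.
Local Notation I := (unitI R).
Local Notation cube := (cube R).
Local Notation clamp := (@clamp R).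

Lemma unitI_eq0 (s : I) : \val s = 0 -> s = clamp 0.
Proof. by move=> s0; rewrite -s0 clampK. Qed.

Lemma unitI_eq1 (s : I) : \val s = 1 -> s = clamp 1.
Proof. by move=> s1; rewrite -s1 clampK. Qed.

Lemma val_clamp0 : \val (clamp 0) = 0.
Proof. by rewrite val_clamp ?lexx ?ler01. Qed.

Lemma val_clamp1 : \val (clamp 1) = 1.
Proof. by rewrite val_clamp ?lexx ?ler01. Qed.

Definition cube_cons n (p : cube n * I) : cube n.+1 :=
  fun i => if unlift ord0 i is Some j then p.1 j else p.2.

Definition cube_tail n (t : cube n.+1) : cube n := fun i => t (lift ord0 i).

Lemma cube_cons0 n (p : cube n * I) : cube_cons p ord0 = p.2.
Proof. by rewrite /cube_cons unlift_none. Qed.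

Lemma cube_consS n (p : cube n * I) i : cube_cons p (lift ord0 i) = p.1 i.
Proof. by rewrite /cube_cons liftK. Qed.

Lemma cube_cons_tail n (t : cube n.+1) : cube_cons (cube_tail t, t ord0) = t.
Proof.
by apply/funext => i; rewrite /cube_cons; case: unliftP => [j ->|->].
Qed.

Lemma cube_tail_cons n (p : cube n * I) : cube_tail (cube_cons p) = p.1.
Proof. by apply/funext => i; exact: cube_consS. Qed.

Lemma continuous_into_cube (X : topologicalType) n (f : X -> cube n) :
  (forall i, continuous (fun x => f x i)) -> continuous f.
Proof. exact: (@continuous_prod_topology 'I_n (fun=> I)). Qed.

Lemma continuous_cube_cons n : continuous (@cube_cons n).
Proof.
apply: continuous_into_cube => i; rewrite /cube_cons.
case: (unlift ord0 i) => [j|]; last exact: continuous_snd.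
exact: (continuous_cube_coord (@continuous_fst _ _)).
Qed.

Lemma continuous_cube_tail n : continuous (@cube_tail n).
Proof.
apply: continuous_into_cube => i.
exact: (continuous_cube_coord (@continuous_id _)).
Qed.

Lemma continuous_cube_split n :
  continuous (fun t : cube n.+1 => (cube_tail t, t ord0)).
Proof.
apply: continuous_pair; first exact: continuous_cube_tail.
exact: (continuous_cube_coord (@continuous_id _)).
Qed.

Lemma bdry_cons n (p : cube n * I) :
  bdry (cube_cons p) <-> [\/ bdry p.1, \val p.2 = 0 | \val p.2 = 1].
Proof.
split => [[i]|[[j pj]|p0|p1]].
- rewrite /cube_cons; case: unliftP => [j _ ?|_ [] ?].
  + by constructor 1; exists j.
  + by constructor 2.
  + by constructor 3.
- by exists (lift ord0 j); rewrite cube_consS.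
- by exists ord0; rewrite cube_cons0; left.
- by exists ord0; rewrite cube_cons0; right.
Qed.

Variable n : nat.

Definition box : set (cube n * I) := [set p | \val p.2 = 0 \/ bdry p.1].

(* The point where the ray from (centre of the cube, 2) through p meets the box
   is [box_ray p (height p)^-1]. *)
Definition height (p : cube n * I) : R := Num.max (cube_rad p.1) (1 - \val p.2 / 2).

Definition box_ray (p : cube n * I) (c : R) : cube n * I :=
  (fun i => clamp (2^-1 + (\val (p.1 i) - 2^-1) * c),
   clamp (2 - (2 - \val p.2) * c)).

Lemma box_ray1 p : box_ray p 1 = p.
Proof.
case: p => t s; congr pair => /=; last by rewrite mulr1 subKr clampK.
by apply/funext => i; rewrite mulr1 addrC subrK clampK.
Qed.

Lemma height_ge p : 2^-1 <= height p.
Proof.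
have := unitI_bounds p.2.
by rewrite /height le_max => s01; apply/orP; right; lra.
Qed.

Lemma height_gt0 p : 0 < height p.
Proof. by apply: lt_le_trans (height_ge p); rewrite invr_gt0. Qed.

Lemma height_le1 p : height p <= 1.
Proof.
by have := unitI_bounds p.2; rewrite /height ge_max cube_rad_le1 /=; lra.
Qed.

Lemma height_box p : box p -> height p = 1.
Proof.
move=> [p0|/bdry_cube_rad p1]; apply/eqP; rewrite eq_le height_le1 /height le_max.
  by rewrite p0 mul0r subr0 lexx orbT.
by rewrite p1 lexx.
Qed.

(** If the radius realises the height, the ray leaves through a side, at a coordinate farthest from
    1/2; otherwise it leaves through the bottom. *)
Lemma box_ray_box p : box (box_ray p (height p)^-1).
Proof.
have h0 := height_gt0 p.
have [hr|hs] : height p = cube_rad p.1 \/ height p = 1 - \val p.2 / 2.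
- by rewrite /height maxEle; case: ifP; [right | left].
- right; have [r0|[i ri]] := cube_rad_attained p.1.
    by move: h0; rewrite hr r0 ltxx.
  have [x1|x1] := leP (2 * \val (p.1 i) - 1) 0.
  + exists i; left; apply: clamp_le0; rewrite hr ri (ler0_norm x1).
    rewrite hr ri (ler0_norm x1) in h0.
    rewrite [X in X <= _](_ : _ = 0) //; field; lra.
  + exists i; right; apply: clamp_ge1; rewrite hr ri (gtr0_norm x1).
    rewrite [X in _ <= X](_ : _ = 1) //; field; lra.
- left; apply: clamp_le0; rewrite hs in h0 *.
  rewrite [X in X <= _](_ : _ = 0) //; field; lra.
Qed.

Lemma continuous_height : continuous height.
Proof.
apply: cont_max; first exact: (continuous_cube_rad (@continuous_fst _ _)).
apply: contB; first exact: continuous_cst.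
apply: contM; last exact: continuous_cst.
exact: (continuous_unitI_val (@continuous_snd _ _)).
Qed.

Lemma continuous_box_ray (X : topologicalType) (f : X -> cube n * I) (c : X -> R) :
  continuous f -> continuous c -> continuous (fun x => box_ray (f x) (c x)).
Proof.
move=> cf cc; apply: continuous_pair.
  apply: continuous_into_cube => i; apply: continuous_clamp.
  apply: contD; first exact: continuous_cst.
  apply: contM => //; apply: contB; last exact: continuous_cst.
  apply: continuous_unitI_val; apply: (@continuous_cube_coord _ X n (fun x => (f x).1)).
  exact: (continuous_compose (@continuous_fst _ _)).
apply: continuous_clamp; apply: contB; first exact: continuous_cst.
apply: contM => //; apply: contB; first exact: continuous_cst.
apply: (@continuous_unitI_val _ X (fun x => (f x).2)).
exact: (continuous_compose (@continuous_snd _ _)).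
Qed.

Lemma continuous_Vheight (X : topologicalType) (f : X -> cube n * I) :
  continuous f -> continuous (fun x => (height (f x))^-1).
Proof.
move=> cf; apply: contV => [x|]; first exact/lt0r_neq0/height_gt0.
exact: (continuous_compose continuous_height).
Qed.

(* The inclusion of the box is a retract of [I^(n+1) * 0 -> I^(n+1) * I]: a
   point p is sent to (p, 1 - height p), and (p, o) back to the point at
   parameter (1 - o) / height p of the ray through p. *)
Lemma box_filling (E B : topologicalType) (p : E -> B) :
  serre_fibration R p -> lifts p box.
Proof.
move=> [_ hlp] F g cF cg pF.
have cr : continuous (fun y => box_ray y (height y)^-1).
  by apply: continuous_box_ray; [exact: continuous_id|
    exact: (continuous_Vheight (@continuous_id _))].
pose sp (t : cube n.+1) : cube n * I := (cube_tail t, t ord0).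
pose c (q : cube n.+1 * I) : R := (1 - \val q.2) * (height (sp q.1))^-1.
pose f t := F (box_ray (sp t) (height (sp t))^-1).
pose H (q : cube n.+1 * I) := g (box_ray (sp q.1) (c q)).
have cF' : continuous (fun y => F (box_ray y (height y)^-1)).
  apply: continuous_withinT; apply: (continuous_within_comp cF cr) => y _.
  exact: box_ray_box.
have cf : continuous f := continuous_compose cF' (@continuous_cube_split n).
have csp1 : continuous (fun q : cube n.+1 * I => sp q.1).
  exact: (continuous_compose (@continuous_cube_split n) (@continuous_fst _ _)).
have cH : continuous H.
  apply: (continuous_compose cg); apply: continuous_box_ray => //.
  apply: contM; last exact: (continuous_Vheight csp1).
  apply: contB; first exact: continuous_cst.
  exact: (continuous_unitI_val (@continuous_snd _ _)).
have Hf t (s : I) : \val s = 0 -> H (t, s) = p (f t).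
  by move=> s0; rewrite /H /c /= s0 subr0 mul1r pF //; exact: box_ray_box.
have [G [cG Gf pG]] := hlp _ _ _ cf cH Hf.
(* At this time the ray parameter is 1, so the lift lies over [g y] itself. On the box the time is
   0, where the lift starts at [F]. *)
exists (fun y => G (cube_cons y, clamp (1 - height y))); split.
- apply: (continuous_compose cG); apply: continuous_pair.
    exact: continuous_cube_cons.
  apply: continuous_clamp; apply: contB; first exact: continuous_cst.
  exact: continuous_height.
- move=> y ybox; rewrite Gf ?(height_box ybox) ?subrr ?val_clamp0 //.
  by rewrite /f /sp cube_tail_cons cube_cons0 -surjective_pairing (height_box ybox)
    invr1 box_ray1.
- move=> y; rewrite pG /H /c /sp /= cube_tail_cons cube_cons0 -surjective_pairing.
  rewrite val_clamp; last by rewrite subr_ge0 height_le1 gerBl ltW ?height_gt0.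
  by rewrite subKr divff ?box_ray1 // lt0r_neq0 ?height_gt0.
Qed.

Lemma closed_side (X : topologicalType) (f : X -> cube n) :
  continuous f -> closed [set x | bdry (f x)].
Proof. by move=> cf; exact: (continuous_closed_preimage cf (@closed_bdry R n)). Qed.

(* [(F, G)] is a homotopy of lifting problems; [L1] and [F], run backwards in
   time, form a box over [G]. *)
Lemma lifts_deform (E B : topologicalType) (p : E -> B)
    (F : cube n * I -> E) (G : cube n * I -> B) (L1 : cube n -> E) :
  serre_fibration R p ->
  {within [set q | bdry q.1], continuous F} -> continuous G ->
  (forall q, bdry q.1 -> p (F q) = G q) ->
  continuous L1 -> (forall t, bdry t -> L1 t = F (t, clamp 1)) ->
  (forall t, p (L1 t) = G (t, clamp 1)) ->
  exists L0 : cube n -> E, [/\ continuous L0,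
    forall t, bdry t -> L0 t = F (t, clamp 0) &
    forall t, p (L0 t) = G (t, clamp 0)].
Proof.
move=> fp cF cG pF cL1 L1F pL1.
pose fl (q : cube n * I) : cube n * I := (q.1, clamp (1 - \val q.2)).
have cfl : continuous fl.
  apply: continuous_pair; first exact: continuous_fst.
  apply: continuous_clamp; apply: contB; first exact: continuous_cst.
  exact: (continuous_unitI_val (@continuous_snd _ _)).
pose F' q := if \val q.2 == 0 then L1 q.1 else F (fl q).
have [|||L [cL LF pL]] := box_filling fp (F := F') (g := fun q => G (fl q)).
- rewrite (_ : box = [set q | \val q.2 = 0] `|` [set q | bdry q.1]) //.
  apply: (@withinU_eq_continuous _ _ _ _ (fun q => L1 q.1)
    (fun q => F (fl q))).
  + exact: (closed_val_eq (@continuous_snd _ _)).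
  + exact: (closed_side (@continuous_fst _ _)).
  + by apply: continuous_subspaceT; exact: (continuous_compose cL1 (@continuous_fst _ _)).
  + exact: (continuous_within_comp cF cfl).
  + by move=> q q0; rewrite /F' (q0 : \val q.2 = 0) eqxx.
  + move=> q qb; rewrite /F'; case: eqP => // q0.
    by rewrite L1F // /fl q0 subr0.
- exact: (continuous_compose cG cfl).
- move=> q; rewrite /F'; case: eqP => [q0 _|q0 [//|qb]].
    by rewrite pL1 /fl q0 subr0.
  by rewrite pF.
- exists (fun t => L (t, clamp 1)); split.
  + apply: (continuous_compose cL); apply: continuous_pair.
      exact: continuous_id.
    exact: continuous_cst.
  + move=> t tb; rewrite LF; last by right.
    by rewrite /F' /fl !val_clamp1 subrr oner_eq0.
  + by move=> t; rewrite pL /fl val_clamp1 subrr.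
Qed.

End boxes.

(** * Trivial Serre fibrations *)

Section trivial_fibrations.
Variable R : realType.
Local Open Scope ring_scope.
Local Notation I := (unitI R).
Local Notation cube := (cube R).
Local Notation clamp := (@clamp R).
Local Notation rad := cube_rad.

(** * A deformation collapsing the bottom and sides *)

Section collapse.
Variable n : nat.
Implicit Types (p : cube n * I) (s : I).

(** The centred vertical coordinate of the image before truncation. The first correction is twice
    the amount by which dilation by [1 + 2 * \val s] pushes the point out of the cube. The second
    vanishes on the top and lowers the bottom from -1 to -5 or less at time 1. *)
Definition depth p s : R :=
  (2 * \val p.2 - 1)
  - 2 * Num.max 0 ((1 + 2 * \val s) * rad p.1 - 1)
  - 2 * \val s * (1 - (2 * \val p.2 - 1)).

(** The horizontal contraction factor: 1 down to depth -1, then decreasing linearly to 0 at depth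
    -2. *)
Definition shrink p s : R := Num.max 0 (1 - Num.max 0 (- 1 - depth p s)).

(* In coordinates centred at 0, the bottom and the sides are pushed down and then
   towards the centre of the bottom, while the top is stretched over the whole
   boundary. *)
Definition collapse p s : cube n * I :=
  (fun i => clamp (2^-1 +
     (\val (clamp ((1 + (1 + 2 * \val s) * (2 * \val (p.1 i) - 1)) / 2)) - 2^-1)
     * shrink p s),
   clamp ((depth p s + 1) / 2)).

Lemma depth0 p : depth p (clamp 0) = 2 * \val p.2 - 1.
Proof.
rewrite /depth val_clamp0 mulr0 addr0 mul1r mul0r subr0 (max_idPl _).
  by rewrite mulr0 subr0.
by rewrite subr_le0 cube_rad_le1.
Qed.

Lemma shrink_ge p s : - 1 <= depth p s -> shrink p s = 1.
Proof.
move=> dp; rewrite /shrink [X in 1 - X](max_idPl _); last by lra.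
by rewrite subr0; apply/max_idPr.
Qed.

Lemma shrink_le p s : depth p s <= - 2 -> shrink p s = 0.
Proof.
move=> dp; rewrite /shrink [X in 1 - X](max_idPr _); last by lra.
by apply/max_idPl; lra.
Qed.

Lemma collapse0 p : collapse p (clamp 0) = p.
Proof.
have pb := unitI_bounds p.2.
rewrite /collapse shrink_ge; last by rewrite depth0; lra.
have h (x : R) : 2 * x / 2 = x by rewrite mulrC mulKf // pnatr_eq0.
rewrite depth0 [RHS]surjective_pairing; congr pair.
  apply: funext => i; rewrite val_clamp0 mulr1 mulr0 addr0 mul1r.
  by rewrite [1 + _]addrC subrK h clampK addrC subrK clampK.
by rewrite subrK h clampK.
Qed.

Lemma continuous_collapse : continuous (fun q : (cube n * I) * I => collapse q.1 q.2).
Proof.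
have cp : continuous (fun q : (cube n * I) * I => q.1) := @continuous_fst _ _.
have cs : continuous (fun q : (cube n * I) * I => \val q.2).
  exact: (continuous_unitI_val (@continuous_snd _ _)).
have cp1 : continuous (fun q : (cube n * I) * I => q.1.1).
  exact: (continuous_compose (@continuous_fst _ _) cp).
have cp2 : continuous (fun q : (cube n * I) * I => \val q.1.2).
  apply: continuous_unitI_val.
  exact: (continuous_compose (@continuous_snd _ _) cp).
have cc (c : R) : continuous (fun q : (cube n * I) * I => c).
  exact: continuous_cst.
have cr := continuous_cube_rad cp1.
have cd : continuous (fun q : (cube n * I) * I => depth q.1 q.2).
  apply: contB; [apply: contB|].
  - by apply: contB => //; apply: contM.
  - apply: contM => //; apply: cont_max => //; apply: contB => //.
    by apply: contM => //; apply: contD => //; apply: contM.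
  - apply: contM; first exact: contM.
    by apply: contB => //; apply: contB => //; apply: contM.
have csh : continuous (fun q : (cube n * I) * I => shrink q.1 q.2).
  by apply: cont_max => //; apply: contB => //; apply: cont_max => //; apply: contB.
apply: continuous_pair.
  apply: continuous_into_cube => i; apply: continuous_clamp.
  apply: contD => //; apply: contM => //; apply: contB => //.
  apply: continuous_unitI_val; apply: continuous_clamp; apply: contM => //.
  apply: contD => //; apply: contM; first by apply: contD => //; exact: contM.
  apply: contB => //; apply: contM => //.
  exact: (continuous_unitI_val (continuous_cube_coord cp1)).
by apply: continuous_clamp; apply: contM => //; exact: contD.
Qed.

(** Above the bottom the contraction factor is 1, so a coordinate dilated past the cube is truncated
    to an endpoint. *)
Lemma collapse_side p s i :
  - 1 <= depth p s -> 1 <= (1 + 2 * \val s) * `|2 * \val (p.1 i) - 1| ->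
  bdry (collapse p s).1.
Proof.
move=> dp xi.
have : (collapse p s).1 i = clamp (2^-1 + (\val (clamp
    ((1 + (1 + 2 * \val s) * (2 * \val (p.1 i) - 1)) / 2)) - 2^-1)
    * shrink p s) by [].
rewrite shrink_ge // mulr1 addrC subrK clampK => ci; exists i; rewrite ci.
have s0 := unitI_bounds s.
have [x0|x0] := leP (2 * \val (p.1 i) - 1) 0.
  left; apply: clamp_le0; rewrite (ler0_norm x0) in xi; lra.
right; apply: clamp_ge1; rewrite (gtr0_norm x0) in xi; lra.
Qed.

(** Points of depth at most -1 land on the bottom. At greater depth values a side point stays on the
    sides, bottom points do not occur, and a top point stays on the top until the dilation carries
    it beyond a side. *)
Lemma bdry_collapse p s : bdry (cube_cons p) -> bdry (cube_cons (collapse p s)).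
Proof.
move=> /bdry_cons bp; apply/bdry_cons.
have s0 := unitI_bounds s.
have [dp|dp] := leP (depth p s) (-1).
  by constructor 2; apply: clamp_le0; lra.
have m0 : 0 <= Num.max 0 ((1 + 2 * \val s) * rad p.1 - 1).
  by rewrite le_max lexx.
case: bp => [/bdry_norm[i pi]|p0|p1].
- constructor 1; apply: (@collapse_side _ _ i); first exact: ltW.
  by rewrite pi; lra.
- by move: dp; rewrite /depth p0; lra.
- have [rp|rp] := leP ((1 + 2 * \val s) * rad p.1) 1.
    constructor 3; apply: clamp_ge1; rewrite /depth p1.
    by rewrite (max_idPl _) ?subr_le0 //; lra.
  constructor 1; have [r0|[i ri]] := cube_rad_attained p.1.
    by move: rp; rewrite r0 mulr0 ltr10.
  by apply: (@collapse_side _ _ i); rewrite -?ri ltW.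
Qed.

Definition collapse_point : cube n * I := (fun=> clamp 2^-1, clamp 0).

(** At time 1 the bottom and the sides have depth at most -2, where [shrink] vanishes. *)
Lemma collapse1 p : box p -> collapse p (clamp 1) = collapse_point.
Proof.
move=> bp; have pb := unitI_bounds p.2.
have m0 : 0 <= Num.max 0 ((1 + 2 * 1) * rad p.1 - 1) by rewrite le_max lexx.
have dp : depth p (clamp 1) <= - 2.
  rewrite /depth val_clamp1; case: bp => [p0|/bdry_cube_rad p1].
    by rewrite p0; lra.
  rewrite p1 (max_idPr _); lra.
rewrite /collapse shrink_le //; congr pair.
  by apply/funext => i; rewrite mulr0 addr0.
by apply/unitI_eq0/clamp_le0; lra.
Qed.

End collapse.

(* Contracting [f] to a constant [f o], with [g] dragged along by the homotopy
   extension property, makes [g] represent an element of [pi_n (B, p (f o))]. *)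
Lemma lifts_bdry_extendable (E B : topologicalType) (p : E -> B) n
    (f : cube n -> E) (g : cube n -> B) :
  serre_fibration R p -> (forall x, @pi_surjective R E B p n x) ->
  continuous f -> continuous g -> (forall t, bdry t -> p (f t) = g t) ->
  exists L : cube n -> E,
    [/\ continuous L, forall t, bdry t -> L t = f t & forall t, p (L t) = g t].
Proof.
move=> fp psurj cf cg pf.
pose c (q : cube n * I) : cube n := fun i => clamp ((1 - \val q.2) * \val (q.1 i)).
have cc : continuous c.
  apply: continuous_into_cube => i; apply: continuous_clamp; apply: contM.
    apply: contB; first exact: continuous_cst.
    exact: (continuous_unitI_val (@continuous_snd _ _)).
  exact: (continuous_unitI_val (continuous_cube_coord (@continuous_fst _ _))).
have c0 t : c (t, clamp 0) = t.
  by apply/funext => i; rewrite /c /= val_clamp0 subr0 mul1r clampK.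
pose o : cube n := fun=> clamp 0.
have c1 t : c (t, clamp 1) = o.
  by apply/funext => i; rewrite /c /= val_clamp1 subrr mul0r.
have cF := continuous_compose cf cc.
have cpF := continuous_compose fp.1 cF.
(* Only the values on the box matter: composing with the retraction [r] extends [g] and the moving
   boundary values over the cylinder. *)
pose Gb (q : cube n * I) := if \val q.2 == 0 then g q.1 else p (f (c q)).
pose r (q : cube n * I) := box_ray q (height q)^-1.
have rbox q : box q -> r q = q.
  by move=> bq; rewrite /r height_box // invr1 box_ray1.
have cr : continuous r.
  by apply: continuous_box_ray; [exact: continuous_id|
    exact: (continuous_Vheight (@continuous_id _))].
have Gbb q : bdry q.1 -> Gb q = p (f (c q)).
  rewrite /Gb; case: eqP => // /unitI_eq0 q0 qb.
  by case: q q0 qb => t s /= -> qb; rewrite c0 pf.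
have cG : continuous (fun q => Gb (r q)).
  apply: continuous_withinT.
  apply: (@continuous_within_comp _ _ _ _ (@box R n) Gb r _ cr) => [|q _].
    rewrite (_ : @box R n = [set q | \val q.2 = 0] `|` [set q | bdry q.1]) //.
    apply: (@withinU_eq_continuous _ _ _ _ (fun q => g q.1)
      (fun q => p (f (c q)))).
    - exact: (closed_val_eq (@continuous_snd _ _)).
    - exact: (closed_side (@continuous_fst _ _)).
    - apply: continuous_subspaceT.
      exact: (continuous_compose cg (@continuous_fst _ _)).
    - exact: continuous_subspaceT.
    - by move=> q q0; rewrite /Gb (q0 : \val q.2 = 0) eqxx.
    - exact: Gbb.
  exact: box_ray_box.
have Gr t s : bdry t -> Gb (r (t, s)) = p (f (c (t, s))).
  by move=> tb; rewrite rbox ?Gbb //; right.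
have g1 : sphere_at (p (f o)) (fun t => Gb (r (t, clamp 1))).
  split=> [|t tb]; last by rewrite Gr // c1.
  apply: (continuous_compose cG (continuous_pair (@continuous_id _)
    (@continuous_cst _ _ _))).
have [u [[cu ub] [H [cH H0 H1 Hb]]]] := psurj _ _ g1.
(* Time is reversed because [lifts_deform] goes from time 1 to time 0: at time 1 the map [u] is a
   lift, and at time 0 the problem is that of the contracted data. *)
have [|||||t|L1 [cL1 L1b pL1]] := @lifts_deform R n E B p (fun=> f o)
  (fun q => H (q.1, clamp (1 - \val q.2))) u fp.
- by apply: continuous_subspaceT; exact: continuous_cst.
- apply: (continuous_compose cH); apply: continuous_pair.
    exact: continuous_fst.
  apply: continuous_clamp; apply: contB; first exact: continuous_cst.
  exact: (continuous_unitI_val (@continuous_snd _ _)).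
- by move=> q qb; rewrite Hb // /= ub.
- exact: cu.
- exact: ub.
- by rewrite H0 //= val_clamp1 subrr val_clamp0.
(* This second deformation undoes the contraction [c]. *)
have [||||||L [cL Lb pL]] := @lifts_deform R n E B p (fun q => f (c q))
  (fun q => Gb (r q)) L1 fp.
- exact: continuous_subspaceT.
- exact: cG.
- by move=> [t s] tb; rewrite Gr.
- exact: cL1.
- by move=> t tb; rewrite L1b // c1.
- by move=> t; rewrite pL1 /= val_clamp0 subr0 H1 // val_clamp1.
exists L; split => // t; first by move=> tb; rewrite Lb // c0.
by rewrite pL rbox; [rewrite /Gb val_clamp0 eqxx | left; rewrite val_clamp0].
Qed.

(** In positive dimension, [collapse] makes the partial lift equal to [F a] on the bottom and sides.
    Its top face is then an element of [pi_n (E, F a)] that [p] kills, because [g] is defined on the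
    whole cube. The null homotopy in [E] extends the partial lift over the cube; the previous lemma
    applies, and the collapse is undone. *)
Theorem trivial_fibration_lifts (E B : topologicalType) (p : E -> B) n :
  serre_fibration R p -> weak_equivalence R p -> lifts p (@bdry R n).
Proof.
move=> fp [cp _ pip] F g cF cg pF.
have psurj m x : @pi_surjective R E B p m x by have [] := pip m x.
case: n => [|n] in F g cF cg pF *.
  have nb (t : cube 0) : ~ bdry t by case=> -[].
  (* The boundary is empty, so any [f] is compatible; [F] merely supplies a point of [E]. *)
  have [|||t|L [cL _ pL]] := @lifts_bdry_extendable E B p 0 (fun=> F (fun=> clamp 0)) g fp.
  - exact: psurj.
  - exact: continuous_cst.
  - exact: cg.
  - by move/nb.
  by exists L; split => // t /nb.
pose k (q : cube n.+1 * I) : cube n.+1 :=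
  cube_cons (collapse (cube_tail q.1, q.1 ord0) q.2).
have ck : continuous k.
  apply: (continuous_compose (@continuous_cube_cons R n)).
  apply: (@continuous_compose _ _ _ (fun q => collapse q.1 q.2)
    (fun q : cube n.+1 * I => ((cube_tail q.1, q.1 ord0), q.2))).
    exact: continuous_collapse.
  apply: continuous_pair; last exact: continuous_snd.
  exact: (continuous_compose (@continuous_cube_split R n) (@continuous_fst _ _)).
have kb q : bdry q.1 -> bdry (k q).
  by move=> qb; apply: bdry_collapse; rewrite cube_cons_tail.
pose k1 (q : cube n * I) : cube n.+1 := k (cube_cons q, clamp 1).
have ck1 : continuous k1.
  apply: (continuous_compose ck).
  exact: (continuous_pair (@continuous_cube_cons _ _) (@continuous_cst _ _ _)).
have k1b q : bdry (cube_cons q) -> bdry (k1 q) by move=> qb; exact: kb.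
pose a : cube n.+1 := cube_cons (@collapse_point n).
have k1box q : box q -> k1 q = a.
  by move=> bq; rewrite /k1 /k /= cube_tail_cons cube_cons0 -surjective_pairing collapse1.
have ab : bdry a by apply/bdry_cons; constructor 2; exact: val_clamp0.
pose u (t : cube n) := F (k1 (t, clamp 1)).
have topb (t : cube n) : bdry (cube_cons (t, clamp 1)).
  by apply/bdry_cons; constructor 3; exact: val_clamp1.
have su : sphere_at (F a) u.
  split => [|t tb]; last by rewrite /u k1box //; right.
  apply: continuous_withinT.
  apply: (@continuous_within_comp _ _ _ _ (@bdry R n.+1) F
    (fun t => k1 (t, clamp 1))) => // [|t _]; last exact/k1b/topb.
  apply: (continuous_compose ck1).
  exact: (continuous_pair (@continuous_id _) (@continuous_cst _ _ _)).
have sa : @sphere_at R E (F a) n (fun=> F a) by split=> //; exact: continuous_cst.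
have cg1 : continuous (fun q => g (k1 q)) := continuous_compose cg ck1.
(* The deformed [g] is itself the homotopy: its bottom and sides lie under the constant part of the
   partial lift, and its top under [u]. *)
have hom : homotopic_rel_bdry (p \o (fun _ : cube n => F a)) (p \o u).
  exists (fun q => g (k1 q)); split => // t s st /=.
  - by rewrite k1box ?pF //; left.
  - by rewrite /u (unitI_eq1 st) pF //; exact: k1b.
  - by rewrite k1box ?pF //; right.
have [H [cH H0 H1 Hb]] := (pip n (F a)).1 _ _ sa su hom.
(* Read as a map on the cube of dimension [n.+1], the homotopy [H] agrees with the deformed partial
   lift on the whole boundary. *)
have HF t : bdry t -> H (cube_tail t, t ord0) = F (k (t, clamp 1)).
  rewrite -{1 4}[t]cube_cons_tail; move: (cube_tail t) (t ord0) => v s vs.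
  rewrite -/(k1 (v, s)); case/bdry_cons: vs => [vb|s0|s1].
  - by rewrite Hb // k1box //; right.
  - by rewrite H0 // k1box //; left.
  - by rewrite H1 // /u (unitI_eq1 (s1 : \val s = 1)).
have [|||t tb|L1 [cL1 L1b pL1]] := @lifts_bdry_extendable E B p n.+1
  (fun t => H (cube_tail t, t ord0)) (fun t => g (k (t, clamp 1))) fp.
- exact: psurj.
- exact: (continuous_compose cH (@continuous_cube_split R n)).
- apply: (continuous_compose cg); apply: (continuous_compose ck).
  exact: (continuous_pair (@continuous_id _) (@continuous_cst _ _ _)).
- by rewrite HF // pF //; exact: kb.
have k0 t : k (t, clamp 0) = t.
  by rewrite /k /= collapse0 cube_cons_tail.
have [||q qb||t tb|t|L [cL Lb pL]] := @lifts_deform R n.+1 E B p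
  (fun q => F (k q)) (fun q => g (k q)) L1 fp.
- exact: (continuous_within_comp cF ck kb).
- exact: (continuous_compose cg ck).
- by rewrite pF //; exact: kb.
- exact: cL1.
- by rewrite L1b // HF.
- exact: pL1.
exists L; split => // t; first by move=> tb; rewrite Lb // k0.
by rewrite pL k0.
Qed.

End trivial_fibrations.

(** * Lifting against cofibrant spaces *)

(** The lifting property of the map from [E] to the product of the [B j], stated by components so
    that no product has to be formed. *)
Definition lifts_fam (E : topologicalType) (J : Type) (B : J -> topologicalType)
    (p : forall j, E -> B j) (K : topologicalType) (A : set K) : Prop :=
  forall (F : K -> E) (g : forall j, K -> B j),
    {within A, continuous F} -> (forall j, continuous (g j)) ->
    (forall j y, A y -> p j (F y) = g j y) ->
    exists L : K -> E, [/\ continuous L, forall y, A y -> L y = F y &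
      forall j y, p j (L y) = g j y].

(** Serves both for the homeomorphism of [cube m * cube n] with [cube (m + n)] and for cofibrant
    spaces as retracts of cell complexes. *)
Lemma lifts_fam_retract (E : topologicalType) (J : Type)
    (B : J -> topologicalType) (p : forall j, E -> B j)
    (K K' : topologicalType) (A : set K) (A' : set K') (r : K -> K')
    (s : K' -> K) :
  continuous r -> continuous s -> cancel r s ->
  (forall y, A y -> A' (r y)) -> (forall y, A' y -> A (s y)) ->
  lifts_fam p A' -> lifts_fam p A.
Proof.
move=> cr cs rK rA sA lift F g cF cg pF.
have [|j|j y /sA/pF //|L [cL LF pL]] :=
    lift (fun y => F (s y)) (fun j y => g j (s y)).
- exact: continuous_within_comp cF cs sA.
- exact: continuous_compose.
exists (fun y => L (r y)); split; first exact: continuous_compose.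
- by move=> y Ay; rewrite LF ?rK //; exact: rA.
- by move=> j y; rewrite pL rK.
Qed.

Section cofibrant_lifting.
Variable R : realType.
Local Notation cube := (cube R).
Variables (E : topologicalType) (J : Type) (B : J -> topologicalType).
Variable p : forall j, E -> B j.
Hypothesis cgwhE : cgwh E.
Hypothesis cgwhB : forall j, cgwh (B j).
Hypothesis cp : forall j, continuous (p j).
Hypothesis p_lifts : forall m, lifts_fam p (@bdry R m).
Variable n : nat.

Lemma lifts_fam_cube2 m :
  lifts_fam p [set q : cube m * cube n | bdry q.1 \/ bdry q.2].
Proof.
pose r (q : cube m * cube n) : cube (m + n) :=
  fun i => match fintype.split i with inl j => q.1 j | inr j => q.2 j end.
pose s (t : cube (m + n)) : cube m * cube n :=
  (fun j => t (lshift n j), fun j => t (rshift m j)).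
apply: (@lifts_fam_retract _ _ _ p _ _ _ (@bdry R (m + n)) r s) => //.
- apply: continuous_into_cube => i; rewrite /r; case: (fintype.split i) => j.
    exact: (continuous_cube_coord (@continuous_fst _ _)).
  exact: (continuous_cube_coord (@continuous_snd _ _)).
- apply: continuous_pair; apply: continuous_into_cube => j;
    exact: (continuous_cube_coord (@continuous_id _)).
- move=> [a b]; congr pair; apply: funext => j; rewrite /r.
    by rewrite (unsplitK (inl j)).
  by rewrite (unsplitK (inr j)).
- move=> [a b] [[j ab]|[j ab]].
    by exists (lshift n j); rewrite /r (unsplitK (inl j)).
  by exists (rshift m j); rewrite /r (unsplitK (inr j)).
- move=> t [i ti]; rewrite -(splitK i) in ti; case: (fintype.split i) ti => j tj.
    by left; exists j.
  by right; exists j.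
Qed.

Lemma curry_map_space (X : topologicalType) (L : X * cube n -> E) :
  compactly_generated X -> continuous L ->
  exists f : X -> map_space (cube n) E,
    continuous f /\ forall x t, f x t = L (x, t).
Proof.
move=> cgX cL.
have cLx x : continuous (fun t => L (x, t)).
  exact: (continuous_compose cL (continuous_pair (@continuous_cst _ _ _)
    (@continuous_id _))).
exists (fun x => continuous_map (cLx x)); split=> //.
apply: continuous_into_map_space => //.
by rewrite (_ : (fun _ => _) = L) //; apply/funext => -[].
Qed.

Definition partial_lift (X : topologicalType) (F : X * cube n -> E)
    (g : forall j, X * cube n -> B j) (L : X * cube n -> E) :=
  [/\ continuous L, forall x t, bdry t -> L (x, t) = F (x, t) &
    forall j x t, p j (L (x, t)) = g j (x, t)].

Lemma continuous_slice (X Z : topologicalType) (L : X * cube n -> Z) t :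
  continuous L -> continuous (fun x => L (x, t)).
Proof.
by move=> cL; apply: (continuous_compose cL (continuous_pair (@continuous_id _)
  (@continuous_cst _ _ _))).
Qed.

Lemma continuous_bdry_slice (X Z : topologicalType) (F : X * cube n -> Z) t :
  {within [set q | bdry q.2], continuous F} -> bdry t ->
  continuous (fun x => F (x, t)).
Proof.
move=> cF tb; apply: continuous_withinT.
apply: (@continuous_within_comp _ _ _ _ [set q : X * cube n | bdry q.2] F
  (fun x => (x, t))) => //.
by apply: continuous_pair; [exact: continuous_id | exact: continuous_cst].
Qed.

(** Over each cell, [LX] on the boundary of the cell and [F] on the boundary of the parameter cube
    pose a lifting problem against the boundary of a larger cube. The solutions, curried into the
    CGWH mapping space, are glued to [LX] by the universal property of the attachment. *)
Lemma cell_attachment_lift (X Y : topologicalType) (i : X -> Y)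
    (F : Y * cube n -> E) (g : forall j, Y * cube n -> B j)
    (LX : X * cube n -> E) :
  compactly_generated X -> cell_attachment R i ->
  {within [set q | bdry q.2], continuous F} -> (forall j, continuous (g j)) ->
  (forall j x t, bdry t -> p j (F (x, t)) = g j (x, t)) ->
  partial_lift (fun q => F (i q.1, q.2)) (fun j q => g j (i q.1, q.2)) LX ->
  exists LY, partial_lift F g LY /\ forall x t, LY (i x, t) = LX (x, t).
Proof.
move=> cgX [D [d [att [chr [ci catt cchr chratt univ]]]]] cF cg pF.
move=> [cLX LXb pLX].
have cell a : {l : cube (d a) * cube n -> E | [/\ continuous l,
    forall s t, l (\val s, t) = LX (att a s, t),
    forall y t, bdry t -> l (y, t) = F (chr a y, t) &
    forall j y t, p j (l (y, t)) = g j (chr a y, t)]}.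
  apply: cid; pose chr' (q : cube (d a) * cube n) := (chr a q.1, q.2).
  have cchr' : continuous chr'.
    apply: continuous_pair; last exact: continuous_snd.
    exact: (continuous_compose (cchr a) (@continuous_fst _ _)).
  pose G (q : cube (d a) * cube n) :=
    if pselect (bdry q.1) is left bq then LX (att a (exist _ q.1 (mem_set bq)), q.2)
    else F (chr' q).
  have G1 s t : G (\val s, t) = LX (att a s, t).
    rewrite /G; case: pselect => /= [bs|[]]; last exact: set_mem (valP s).
    by congr (LX (att a _, t)); apply: val_inj.
  have G2 y t : bdry t -> G (y, t) = F (chr a y, t).
    rewrite /G; case: pselect => /= [bs tb|//]; rewrite LXb //=.
    by rewrite -chratt.
  have [|j|j [y t]|L [cL LG pL]] := lifts_fam_cube2 (m := d a) (F := G)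
      (g := fun j q => g j (chr' q)).
  - rewrite (_ : [set q | _] = [set q | bdry q.1] `|` [set q | bdry q.2]) //.
    apply: (@withinU_eq_continuous _ _ _ _ G (fun q => F (chr' q))) => //.
    + exact: (closed_side (@continuous_fst _ _)).
    + exact: (closed_side (@continuous_snd _ _)).
    (* The attaching map is defined on a subtype, so continuity is checked after restriction to a
       subtype, where the case distinction in [G] disappears. *)
    + apply/subspace_sigL_continuousP.
      pose b (q : set_type [set q : cube (d a) * cube n | bdry q.1]) :
          set_type (@bdry R (d a)) :=
        exist _ (\val q).1 (mem_set (set_mem (valP q))).
      have cb : continuous b.
        apply: continuous_into_set_type.
        exact: (continuous_compose (@continuous_fst _ _) (@continuous_set_val _ _)).
      rewrite (_ : sigL _ _ = fun q => LX (att a (b q), (\val q).2)).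
        apply: (continuous_compose cLX); apply: continuous_pair.
          exact: (continuous_compose (catt a) cb).
        exact: (continuous_compose (@continuous_snd _ _) (@continuous_set_val _ _)).
      by apply: funext => q; rewrite -G1 /sigL /= -surjective_pairing.
    + exact: (continuous_within_comp cF cchr').
    + by move=> [y t] /= tb; rewrite G2.
  - exact: (continuous_compose (cg j) cchr').
  - rewrite /G; case: pselect => /= [bs _|nb [//|tb]]; last exact: pF.
    by rewrite pLX /= -chratt.
  - exists L; split=> //.
    + by move=> s t; rewrite LG ?G1 //; left; exact: set_mem (valP s).
    + by move=> y t tb; rewrite LG ?G2 //; right.
pose l a := sval (cell a); have lP a := svalP (cell a).
have cl a : continuous (l a) by case: (lP a).
have [fX [cfX fXE]] := curry_map_space cgX cLX.
have hx a := cid (curry_map_space (@cube_cg R (d a)) (cl a)).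
have [h hP] : {h : forall a, cube (d a) -> map_space (cube n) E |
    forall a, continuous (h a) /\ forall y t, h a y t = l a (y, t)}.
  by exists (fun a => sval (hx a)) => a; exact: svalP (hx a).
have cgE := map_space_cgwh (@cube_compact R n) (@cube_hausdorff R n) cgwhE.
have [a|a s|k [[ck ki kchr] _]] := univ _ fX h cgE cfX.
- by case: (hP a).
- apply/continuousEP => t; rewrite fXE (hP a).2.
  by have [_ lE _ _] := lP a; exact: lE.
have kiE x t : k (i x) t = LX (x, t) by rewrite -fXE -ki.
have kchrE a y t : k (chr a y) t = l a (y, t).
  by rewrite -(hP a).2 -kchr.
have ckE := continuous_map_space_eval (@cube_compact R n) (@cube_hausdorff R n) ck.
have uniq (Z : topologicalType) (u v : Y -> Z) : cgwh Z -> continuous u ->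
    continuous v -> (forall x, u (i x) = v (i x)) ->
    (forall a y, u (chr a y) = v (chr a y)) -> u = v.
  move=> cgZ cu cv ui uchr.
  have [|a|a s|w [_ wu]] := univ Z (u \o i) (fun a => u \o chr a) cgZ.
  - exact: (continuous_compose cu ci).
  - exact: (continuous_compose cu (cchr a)).
  - by rewrite /= chratt.
  rewrite -(wu u) //; apply: (wu v); split => // [|a].
    by apply: funext => x; rewrite /= ui.
  by apply: funext => y; rewrite /= uchr.
exists (fun q => k q.1 q.2); split => //; split => //.
(* Uniqueness concerns maps out of [Y] alone, so this equation and the next are proved at a fixed
   parameter [t], by comparison on [X] and on the cells. *)
- move=> x t tb; suff e : (fun y => k y t) = (fun y => F (y, t)).
    exact: (congr1 (fun u => u x) e).
  apply: (uniq _ (fun y => k y t) (fun y => F (y, t)) cgwhE).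
  + exact: (continuous_slice ckE).
  + exact: continuous_bdry_slice.
  + by move=> x'; rewrite kiE LXb.
  + by move=> a y; rewrite kchrE; have [_ _ lE _] := lP a; exact: lE.
- move=> j x t; suff e : (fun y => p j (k y t)) = (fun y => g j (y, t)).
    exact: (congr1 (fun u => u x) e).
  apply: (uniq _ (fun y => p j (k y t)) (fun y => g j (y, t)) (cgwhB j)).
  + exact: (continuous_compose (@cp j) (continuous_slice ckE)).
  + exact: (continuous_slice (cg j)).
  + by move=> x'; rewrite kiE pLX.
  + by move=> a y; rewrite kchrE; have [_ _ _ lE] := lP a; exact: lE.
Qed.

(** Lifts are chosen stage by stage, each extending the previous one, from the empty stage on. Their
    curried forms are a cocone, which factors through the colimit; uniqueness of factorizations
    gives the equations at each parameter. *)
Lemma cell_complex_lifts (C : topologicalType) :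
  cell_complex R C -> lifts_fam p [set q : C * cube n | bdry q.2].
Proof.
move=> [[cgC _] [S [i [c [cgS S0 ica cc univ]]]]] F g cF cg pF.
have cci k x : c k.+1 (i k x) = c k x by rewrite -(cc k).2.
pose Fk k (q : S k * cube n) := F (c k q.1, q.2).
pose gk k j (q : S k * cube n) := g j (c k q.1, q.2).
have cck k : continuous (fun q : S k * cube n => (c k q.1, q.2)).
  apply: continuous_pair; last exact: continuous_snd.
  exact: (continuous_compose (cc k).1 (@continuous_fst _ _)).
(* Each lift is packed with its proof so that the extension can be iterated by [nat_rect]. *)
have step k (L : {L | partial_lift (Fk k) (gk k) L}) :
    {L' : {L' | partial_lift (Fk k.+1) (gk k.+1) L'} |
      forall x t, sval L' (i k x, t) = sval L (x, t)}.
  apply: cid; case: L => L PL.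
  have [|j|j x t tb||L' [PL' L'i]] := @cell_attachment_lift _ _ (i k) (Fk k.+1)
      (gk k.+1) L (cgS k).1 (ica k).
  - exact: (continuous_within_comp cF (cck k.+1)).
  - exact: (continuous_compose (cg j) (cck k.+1)).
  - exact: pF.
  - case: PL => cL Lb pL; split => // [x t tb|j x t].
      by rewrite Lb // /Fk /= cci.
    by rewrite pL /gk /= cci.
  by exists (exist _ L' PL').
have L0 : {L | partial_lift (Fk 0) (gk 0) L}.
  have n0 (q : S 0 * cube n) : False by apply: S0; exists; exact: q.1.
  exists (fun q => False_rect _ (n0 q)).
  by split=> [q|x t|j x t]; case: (n0 _).
pose L := nat_rect (fun k => {L | partial_lift (Fk k) (gk k) L}) L0
  (fun k L => sval (step k L)).
have Li k x t : sval (L k.+1) (i k x, t) = sval (L k) (x, t).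
  exact: (svalP (step k (L k))).
have cL k : continuous (sval (L k)) by case: (svalP (L k)).
have Lf k : {f : S k -> map_space (cube n) E |
    continuous f /\ forall x t, f x t = sval (L k) (x, t)}.
  exact/cid/(curry_map_space (cgS k).1 (cL k)).
have cgE := map_space_cgwh (@cube_compact R n) (@cube_hausdorff R n) cgwhE.
have [|k|u [[cu uc] _]] := univ _ (fun k => sval (Lf k)) cgE.
- by move=> k; case: (svalP (Lf k)).
- apply: funext => x; apply/continuousEP => t /=.
  by rewrite (svalP (Lf k.+1)).2 (svalP (Lf k)).2 Li.
have ucE k x t : u (c k x) t = sval (L k) (x, t).
  by rewrite -(svalP (Lf k)).2 -uc.
have cuE := continuous_map_space_eval (@cube_compact R n) (@cube_hausdorff R n) cu.
have uniq (Z : topologicalType) (v w : C -> Z) : cgwh Z -> continuous v ->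
    continuous w -> (forall k x, v (c k x) = w (c k x)) -> v = w.
  move=> cgZ cv cw vc.
  have [|k|z [_ zu]] := univ Z (fun k => v \o c k) cgZ.
  - by move=> k; exact: (continuous_compose cv (cc k).1).
  - by apply: funext => x; rewrite /= cci.
  rewrite -(zu v) //; apply: (zu w); split => // k.
  by apply: funext => x; rewrite /= vc.
exists (fun q => u q.1 q.2); split => //.
- move=> [x t] /= tb; suff e : (fun y => u y t) = (fun y => F (y, t)).
    exact: (congr1 (fun v => v x) e).
  apply: (uniq _ (fun y => u y t) (fun y => F (y, t)) cgwhE).
  + exact: (continuous_slice cuE).
  + exact: continuous_bdry_slice.
  + by move=> k x'; rewrite ucE; case: (svalP (L k)) => _ ->.
- move=> j [x t] /=; suff e : (fun y => p j (u y t)) = (fun y => g j (y, t)).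
    exact: (congr1 (fun v => v x) e).
  apply: (uniq _ (fun y => p j (u y t)) (fun y => g j (y, t)) (cgwhB j)).
  + exact: (continuous_compose (@cp j) (continuous_slice cuE)).
  + exact: (continuous_slice (cg j)).
  + by move=> k x'; rewrite ucE; case: (svalP (L k)) => _ _ ->.
Qed.

Theorem serre_cofibrant_lifts (X : topologicalType) :
  serre_cofibrant R X -> lifts_fam p [set q : X * cube n | bdry q.2].
Proof.
move=> [C [s [r [ccC cs cr sK]]]].
have cpair (Y Z : topologicalType) (f : Y -> Z) : continuous f ->
    continuous (fun q : Y * cube n => (f q.1, q.2)).
  move=> cf; apply: continuous_pair; last exact: continuous_snd.
  exact: (continuous_compose cf (@continuous_fst _ _)).
apply: (lifts_fam_retract (cpair _ _ _ cs) (cpair _ _ _ cr) _ _ _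
  (cell_complex_lifts ccC)) => //.
by move=> [x t]; rewrite /= sK.
Qed.

End cofibrant_lifting.

(** * Restriction to the axes of a power *)

Section mapping_theory.
Variable T : mappingTheory.
Implicit Types A B C X : T.

Lemma continuous_mcomp (K : topologicalType) A B C (f : K -> mor B C)
    (g : K -> mor A B) :
  compactly_generated K -> continuous f -> continuous g ->
  continuous (fun x => mcomp (f x) (g x)).
Proof.
move=> cgK cf cg.
exact: (continuous_compose (@mcomp_continuous _ A B C) (continuous_kpair cgK cf cg)).
Qed.

Lemma continuous_mcompl A B C (y : mor A B) :
  continuous (fun x : mor B C => mcomp x y).
Proof.
apply: continuous_mcomp; [exact: (mor_cgwh _ _).1|exact: continuous_id|
  exact: continuous_cst].
Qed.

Lemma mpair_ext (J : finType) (A : J -> T) X (f g : mor X (mprod A)) :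
  (forall j, mcomp (mproj A j) f = mcomp (mproj A j) g) -> f = g.
Proof.
move=> fg; rewrite -(mpair_mproj f) -(mpair_mproj g); congr mpair.
exact: functional_extensionality_dep.
Qed.

Lemma mpair_mcomp (J : finType) (A : J -> T) X Y (f : forall j, mor X (A j))
    (h : mor Y X) :
  mcomp (mpair f) h = mpair (fun j => mcomp (f j) h).
Proof. by apply: mpair_ext => j; rewrite mcompA !mproj_mpair. Qed.

Definition mpower (n : nat) A : T := mprod (fun _ : 'I_n => A).

Definition axis (n : nat) A (k : 'I_n) : mor A (mpower n A) :=
  mpair (fun l => if l == k then mor1 A else mor0 A A).

Lemma mproj_axis n A (k l : 'I_n) :
  mcomp (mproj _ l) (axis A k) = if l == k then mor1 A else mor0 A A.
Proof. exact: mproj_mpair. Qed.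

Lemma mproj_true X A B (f : mor X A) (g : mor X B) :
  mcomp (mproj (bfam A B) true) (bpair f g) = f.
Proof. exact: (mproj_mpair (A := bfam A B) _ true). Qed.

Lemma mproj_false X A B (f : mor X A) (g : mor X B) :
  mcomp (mproj (bfam A B) false) (bpair f g) = g.
Proof. exact: (mproj_mpair (A := bfam A B) _ false). Qed.

Variables (R : realType) (L : leftLinear T).
Hypothesis bilinear : weakly_bilinear R L.

(* [A^(n+2)] is identified with [A * A^(n+1)], where restriction to the two
   axes is a trivial fibration. *)
Theorem axes_lifts n A B m :
  lifts_fam (fun (k : 'I_n.+1) (f : mor (mpower n.+1 A) B) => mcomp f (axis A k))
    (@bdry R m).
Proof.
elim: n => [|n IH] F g cF cg pF.
  (* The only axis of the first power is an isomorphism, with the projection as inverse, so the lift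
     is forced. *)
  exists (fun y => mcomp (g ord0 y) (mproj _ ord0)); split.
  - exact: (continuous_compose (@continuous_mcompl _ _ _ _) (cg ord0)).
  - move=> y yb; rewrite -pF // -mcompA -[RHS]mcompm1; congr mcomp.
    by apply: mpair_ext => j; rewrite mcompA mproj_axis !ord1 eqxx mcomp1m mcompm1.
  - by move=> j y; rewrite -mcompA mproj_axis !ord1 eqxx mcompm1.
pose P := mpower n.+1 A; pose Q := bprod A P.
pose th : mor (mpower n.+2 A) Q :=
  bpair (mproj _ ord0) (mpair (fun i : 'I_n.+1 => mproj _ (lift ord0 i))).
pose th' : mor Q (mpower n.+2 A) := mpair (fun i : 'I_n.+2 =>
  if unlift ord0 i is Some j then mcomp (mproj _ j) (mproj (bfam A P) false)
  else mproj (bfam A P) true).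
have thK : mcomp th' th = mor1 _.
  apply: mpair_ext => i; rewrite mcompA mproj_mpair mcompm1.
  case: unliftP => [j ->|->]; last exact: mproj_true.
  by rewrite -mcompA mproj_false mproj_mpair.
have th0 : mcomp th' (incl1 A P) = axis A ord0.
  apply: mpair_ext => i; rewrite mcompA mproj_mpair mproj_axis.
  case: unliftP => [j ->|->]; last by rewrite eqxx; exact: mproj_true.
  by rewrite -mcompA mproj_false mcompm0.
have thS k : mcomp th' (mcomp (incl2 A P) (axis A k)) = axis A (lift ord0 k).
  apply: mpair_ext => i; rewrite mcompA mproj_mpair mproj_axis mcompA.
  case: unliftP => [j ->|->].
    by rewrite -!mcompA (mcompA (mproj _ false)) mproj_false mcomp1m mproj_axis
      (inj_eq lift_inj).
  by rewrite mproj_true mcomp0m (negbTE (neq_lift _ _)).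
have th_axis k : mcomp th (axis A k) =
    if unlift ord0 k is Some j then mcomp (incl2 A P) (axis A j) else incl1 A P.
  apply: mpair_ext => -[]; rewrite mcompA ?mproj_true ?mproj_false.
    rewrite mproj_axis; case: unliftP => [j ->|->].
      by rewrite mcompA mproj_true mcomp0m (negbTE (neq_lift _ _)).
    by rewrite mproj_true eqxx.
  rewrite mpair_mcomp; apply: mpair_ext => i; rewrite mproj_mpair mproj_axis.
  case: unliftP => [j ->|->].
    by rewrite (mcompA (mproj _ false)) mproj_false mcomp1m mproj_axis
      (inj_eq lift_inj).
  by rewrite mproj_false mcompm0 eq_sym (negbTE (neq_lift _ _)).
have cF' C (y : mor C _) : {within @bdry R m, continuous (fun x => mcomp (F x) y)}.
  exact: (continuous_compose (@continuous_mcompl _ _ _ _) cF).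
(* The last [n.+1] axes are handled first, on the factor [P]. The result, paired with [g ord0], is
   the base of a lifting problem for [restr]. *)
have [|j|j y yb|L1 [cL1 L1b pL1]] := IH
    (fun y => mcomp (F y) (mcomp th' (incl2 A P))) (fun j y => g (lift ord0 j) y).
- exact: cF'.
- exact: cg.
- by rewrite -mcompA -[mcomp (mcomp _ _) _]mcompA thS pF.
have [fib we] := bilinear A P B.
have [||y yb|L2 [cL2 L2b pL2]] := trivial_fibration_lifts fib we
    (F := fun y => mcomp (F y) th') (g := fun y => (g ord0 y, L1 y)) (n := m).
- exact: cF'.
- apply: continuous_kpair; [exact: cube_cg | exact: cg | exact: cL1].
- by rewrite /restr L1b // -!mcompA th0 pF.
exists (fun y => mcomp (L2 y) th); split.
- exact: (continuous_compose (@continuous_mcompl _ _ _ _) cL2).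
- by move=> y yb; rewrite L2b // -mcompA thK mcompm1.
- move=> k y; rewrite -mcompA th_axis; have [r1 r2] : restr (L2 y) = (g ord0 y, L1 y) := pL2 y.
  case: unliftP => [j ->|->]; last exact: r1.
  by rewrite mcompA r2 pL1.
Qed.

End mapping_theory.

(** * Sequences of arguments and parameters *)

Lemma update_fam (P : nat -> Type) (f : forall n, P n) N (v : P N) :
  exists g : forall n, P n, g N = v /\ forall n, (n < N)%N -> g n = f n.
Proof.
exists (fun n => match N =P n with ReflectT e => ecast n (P n) e v | _ => f n end).
split=> [|n nN]; first by case: eqP => // e; rewrite eq_axiomK.
by case: eqP => // e; exfalso; move: nN; rewrite -e ltnn.
Qed.

(** A step may change the family from index [N] on, but keeps everything below. Since [Q n] depends
    only on the values up to [n], the diagonal of the successive families satisfies every [Q n]. *)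
Lemma strong_dependent_choice (P : nat -> Type)
    (Q : nat -> (forall n, P n) -> Prop) (f0 : forall n, P n) :
  (forall N f g, (forall k, (k <= N)%N -> f k = g k) -> Q N f -> Q N g) ->
  (forall N f, (forall n, (n < N)%N -> Q n f) ->
     exists2 g, forall n, (n < N)%N -> g n = f n & Q N g) ->
  exists f, forall n, Q n f.
Proof.
move=> Qloc step.
pose S N := {f | forall n, (n < N)%N -> Q n f}.
have next N (f : S N) : {g : S N.+1 | forall n, (n < N)%N -> sval g n = sval f n}.
  apply: cid; case: f => f Qf; have [g gf Qg] := step N f Qf.
  have Qg' n : (n < N.+1)%N -> Q n g.
    rewrite ltnS leq_eqVlt => /predU1P[-> //|nN]; apply: Qloc (Qf n nN) => k kn.
    by rewrite gf // (leq_ltn_trans kn).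
  by exists (exist _ g Qg').
have S0 : S 0 by exists f0.
pose G := nat_rect S S0 (fun N f => sval (next N f)).
have GS N n : (n < N)%N -> sval (G N.+1) n = sval (G N) n.
  exact: (svalP (next N (G N))).
have GE N n : (n < N)%N -> sval (G N) n = sval (G n.+1) n.
  elim: N => // N IH; rewrite ltnS leq_eqVlt => /predU1P[-> //|nN].
  by rewrite GS // IH.
exists (fun n => sval (G n.+1) n) => n.
by apply: Qloc (svalP (G n.+1) n (ltnSn n)) => k kn; rewrite GE.
Qed.

(* Arguments x_0, ..., x_n and parameters t_0, ..., t_(n-1) are sequences indexed by
   [nat] whose remaining entries are ignored; this keeps the sizes n - i of the
   faces out of the types. *)
Section sequences.
Variables (T : mappingTheory) (L : leftLinear T).
Implicit Types (X A B : T) (I : Type).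

Definition iskip I (i : nat) (t : nat -> I) (l : nat) : I := t (bump i l).

Definition ishift I (i : nat) (t : nat -> I) (l : nat) : I := t (i + l)%N.

Definition imerge X A (i : nat) (x : nat -> mor X A) (l : nat) : mor X A :=
  if (l < i)%N then x l else if l == i then madd L (x i) (x i.+1) else x l.+1.

Lemma skip_lt I i (t : nat -> I) l : (l < i)%N -> iskip i t l = t l.
Proof. by move=> li; rewrite /iskip /bump leqNgt li. Qed.

Lemma skip_ge I i (t : nat -> I) l : (i <= l)%N -> iskip i t l = t l.+1.
Proof. by move=> il; rewrite /iskip /bump il. Qed.

Lemma merge_lt X A i (x : nat -> mor X A) l : (l < i)%N -> imerge i x l = x l.
Proof. by rewrite /imerge => ->. Qed.

Lemma merge_eq X A i (x : nat -> mor X A) : imerge i x i = madd L (x i) (x i.+1).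
Proof. by rewrite /imerge ltnn eqxx. Qed.

Lemma merge_gt X A i (x : nat -> mor X A) l : (i < l)%N -> imerge i x l = x l.+1.
Proof. by move=> il; rewrite /imerge ltnNge ltnW //= gtn_eqF. Qed.

Lemma skip_skip I i j (t : nat -> I) : (i <= j)%N ->
  iskip j (iskip i t) =1 iskip i (iskip j.+1 t).
Proof.
move=> ij l; rewrite /iskip; congr t; rewrite /bump; lia.
Qed.

(** The simplicial identity for arguments that corresponds to [skip_skip] for parameters; the case
    [i = j] is associativity of addition. *)
Lemma merge_merge X A i j (x : nat -> mor X A) : (i <= j)%N ->
  imerge j (imerge i x) =1 imerge i (imerge j.+1 x).
Proof.
move=> ij l; case: (ltngtP l i) => [li|il|->].
- by rewrite (merge_lt _ (leq_trans li ij)) !(merge_lt _ li) merge_lt //; lia.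
- rewrite (merge_gt _ il); case: (ltngtP l j) => [lj|jl|lj].
  + by rewrite (merge_lt _ lj) (merge_gt _ il) merge_lt.
  + by rewrite (merge_gt _ jl) !merge_gt //; lia.
  + by rewrite lj in il *; rewrite !merge_eq !merge_gt //; lia.
- case: (ltngtP i j) ij => // [ij _|-> _].
    by rewrite (merge_lt _ ij) !merge_eq !merge_lt //; lia.
  by rewrite !merge_eq merge_gt // merge_lt // maddA.
Qed.

Lemma shift_merge X A i j (x : nat -> mor X A) : (i < j)%N ->
  ishift j (imerge i x) =1 ishift j.+1 x.
Proof. by move=> ij l; rewrite /ishift merge_gt ?addSn // ltn_addr. Qed.

Lemma shift_skip I i j (t : nat -> I) : (i <= j)%N ->
  ishift j (iskip i t) =1 ishift j.+1 t.
Proof. by move=> ij l; rewrite /ishift skip_ge ?addSn // (leq_trans ij) ?leq_addr. Qed.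

Lemma merge_shift X A i j (x : nat -> mor X A) :
  imerge j (ishift i x) =1 ishift i (imerge (i + j) x).
Proof.
move=> l; rewrite /imerge /ishift ltn_add2l eqn_add2l !addnS; case: ifP => // _.
Qed.

Lemma skip_shift I i j (t : nat -> I) :
  iskip j (ishift i t) =1 ishift i (iskip (i + j) t).
Proof. by move=> l; rewrite /iskip /ishift /bump leq_add2l addnCA. Qed.

Lemma shift_shift I i j (t : nat -> I) : ishift j (ishift i t) =1 ishift (i + j) t.
Proof. by move=> l; rewrite /ishift addnA. Qed.

Lemma merge_mcomp X Y A i (x : nat -> mor X A) (y : mor Y X) l :
  mcomp (imerge i x l) y = imerge i (fun l => mcomp (x l) y) l.
Proof. by rewrite /imerge; case: ifP => // _; case: ifP => // _; rewrite mcomp_addl. Qed.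

Definition delta X A (k : nat) (x : mor X A) (l : nat) : mor X A :=
  if l == k then x else mor0 X A.

(** Adding zeros leaves a single possibly nonzero entry, moved down by one place if it lay beyond
    [i]. *)
Lemma merge_delta X A i k (x : mor X A) :
  imerge i (delta k x) =1 delta (if (k <= i)%N then k else k.-1) x.
Proof.
move=> l; rewrite /delta; case: (ltngtP l i) => [li|il|->].
- by rewrite merge_lt //; congr (if _ then _ else _); case: ifP => ?; lia.
- by rewrite merge_gt //; congr (if _ then _ else _); case: ifP => ?; lia.
- rewrite merge_eq; case: (ltngtP k i) => [ki|ik|->].
  + by rewrite !gtn_eqF ?madd0m // ltnW.
  + by rewrite madd0m; congr (if _ then _ else _); lia.
  + by rewrite eqxx gtn_eqF // maddm0.
Qed.

Lemma shift_delta X A i k (x : mor X A) : (i <= k)%N ->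
  ishift i (delta k x) =1 delta (k - i) x.
Proof. by move=> ik l; rewrite /ishift /delta; congr (if _ then _ else _); lia. Qed.

End sequences.

(** * Face conditions and their compatibility *)

Section universal_cubes.
Variables (R : realType) (T : mappingTheory) (L : leftLinear T).
Local Notation I := (unitI R).
Local Notation cube := (cube R).
Local Notation endpoint b := (@clamp R (b : bool)%:R%R).
Implicit Types (X A B : T).

(** Holds the cubes at the tuple of projections only; continuity is imposed later, in [good]. The
    ordinary product is already compactly generated, as the cube is compact Hausdorff. *)
Definition level (n : nat) : Type :=
  forall A B, (mor A B * cube n)%type -> mor (mpower n.+1 A) B.

(** Precomposition with the tuple builds in universality, so that equations can be checked at the
    projections. *)
Definition cube_eval (Phi : forall n, level n) n X A B (a : mor A B)
    (x : nat -> mor X A) (t : nat -> I) : mor X B :=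
  mcomp (Phi n A B (a, (fun i : 'I_n => t i) : cube n))
    (mpair (fun i : 'I_n.+1 => x i)).

(* The value that the face condition prescribes where t_i = e. *)
Definition face_value (Phi : forall n, level n) m (e : bool) i X A B
    (a : mor A B) (x : nat -> mor X A) (t : nat -> I) : mor X B :=
  if e then madd L (cube_eval Phi i a x t)
                   (cube_eval Phi (m - i) a (ishift i.+1 x) (ishift i.+1 t))
  else cube_eval Phi m a (imerge L i x) (iskip i t).

Definition faces (Phi : forall n, level n) m : Prop :=
  forall e i X A B (a : mor A B) (x : nat -> mor X A) (t : nat -> I),
    (i <= m)%N -> t i = endpoint e ->
    cube_eval Phi m.+1 a x t = face_value Phi m e i a x t.

Lemma cube_eval_ext (Phi : forall n, level n) n X A B (a : mor A B)
    (x x' : nat -> mor X A) (t t' : nat -> I) :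
  (forall l, (l <= n)%N -> x l = x' l) -> (forall l, (l < n)%N -> t l = t' l) ->
  cube_eval Phi n a x t = cube_eval Phi n a x' t'.
Proof.
move=> xx' tt'; rewrite /cube_eval.
have -> : (fun i : 'I_n => t i) = (fun i : 'I_n => t' i).
  by apply/funext => i; rewrite tt'.
have -> // : (fun i : 'I_n.+1 => x i) = (fun i : 'I_n.+1 => x' i).
by apply/funext => i; rewrite xx' // -ltnS.
Qed.

Lemma cube_eval_eq (Phi Psi : forall n, level n) n : Phi n = Psi n ->
  forall X A B (a : mor A B) (x : nat -> mor X A) (t : nat -> I),
    cube_eval Phi n a x t = cube_eval Psi n a x t.
Proof. by move=> e X A B a x t; rewrite /cube_eval e. Qed.

Lemma face_value_eq (Phi Psi : forall n, level n) m e i :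
  (forall n, (n <= m)%N -> Phi n = Psi n) -> (i <= m)%N ->
  forall X A B (a : mor A B) (x : nat -> mor X A) (t : nat -> I),
    face_value Phi m e i a x t = face_value Psi m e i a x t.
Proof.
move=> eqP im X A B a x t; rewrite /face_value; case: e.
  by congr madd; apply: cube_eval_eq; apply: eqP; rewrite ?leq_subr.
by apply: cube_eval_eq; exact: eqP.
Qed.

Lemma cube_eval_mcomp Phi n X Y A B (a : mor A B) (x : nat -> mor X A) (t : nat -> I)
    (y : mor Y X) :
  mcomp (cube_eval Phi n a x t) y = cube_eval Phi n a (fun l => mcomp (x l) y) t.
Proof. by rewrite /cube_eval -mcompA mpair_mcomp. Qed.

Lemma face_value_mcomp Phi m e i X Y A B (a : mor A B) (x : nat -> mor X A)
    (t : nat -> I) (y : mor Y X) :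
  mcomp (face_value Phi m e i a x t) y =
  face_value Phi m e i a (fun l => mcomp (x l) y) t.
Proof.
rewrite /face_value; case: e; first by rewrite mcomp_addl !cube_eval_mcomp.
rewrite cube_eval_mcomp; apply: cube_eval_ext => // l _; exact: merge_mcomp.
Qed.

Lemma face_value_ext Phi m e i X A B (a : mor A B) (x x' : nat -> mor X A)
    (t t' : nat -> I) :
  (i <= m)%N ->
  (forall l, (l <= m.+1)%N -> x l = x' l) ->
  (forall l, (l <= m)%N -> t l = t' l) ->
  face_value Phi m e i a x t = face_value Phi m e i a x' t'.
Proof.
move=> im xx' tt'; rewrite /face_value; case: e.
  congr madd; apply: cube_eval_ext => l lm; rewrite /ishift ?xx' ?tt' //; lia.
apply: cube_eval_ext => l lm; last by rewrite /iskip tt' // /bump; lia.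
by rewrite /imerge !xx' //; lia.
Qed.

(** The face conditions of lower levels expand both values once more. Two splittings give the same
    three summands up to associativity; a merge and a splitting commute, the merge acting inside one
    summand; two merges commute by [merge_merge]. *)
Lemma face_value_compat Phi m e d i j X A B (a : mor A B)
    (x : nat -> mor X A) (t : nat -> I) :
  (forall n, (n < m)%N -> faces Phi n) -> (i < j <= m)%N ->
  t i = endpoint e -> t j = endpoint d ->
  face_value Phi m e i a x t = face_value Phi m d j a x t.
Proof.
move=> fP /andP[ij jm] ti tj.
case: m => [|m] in fP jm *; first by move: jm; rewrite leqn0 => /eqP j0; rewrite j0 in ij.
(* From here on the second index is [j.+1] with [i <= j], as in the simplicial identities. *)
case: j => [//|j] in ij jm tj *; rewrite ltnS in ij; rewrite ltnS in jm.
have skj : iskip i t j = t j.+1 by rewrite skip_ge.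
have ski : iskip j.+1 t i = t i by rewrite skip_lt.
case: e ti => ti; case: d tj => tj; rewrite /face_value.
- rewrite (fP j jm true i) // /face_value subSn ?(leq_trans ij) //.
  rewrite (fP (m - i)%N _ true (j - i)%N) /face_value; first last.
  + by rewrite /ishift -tj; congr t; lia.
  + by lia.
  + by lia.
  rewrite -maddA; congr madd; congr madd.
  rewrite (_ : m - i - (j - i) = m.+1 - j.+1)%N; last by lia.
  have ij2 : (i.+1 + (j - i).+1 = j.+2)%N by lia.
  by apply: cube_eval_ext => l _; rewrite shift_shift ij2.
- rewrite (fP m (ltnSn m) true i) ?ski ?(leq_trans ij) // /face_value.
  rewrite subSn ?(leq_trans ij) // (fP (m - i)%N _ false (j - i)%N); first last.
  + by rewrite /ishift -tj; congr t; lia.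
  + by lia.
  + by lia.
  have ij1 : (i.+1 + (j - i) = j.+1)%N by lia.
  congr madd; apply: cube_eval_ext => l li.
  + by rewrite merge_lt //; lia.
  + by rewrite skip_lt //; lia.
  + by rewrite merge_shift ij1.
  + by rewrite skip_shift ij1.
- rewrite (fP m (ltnSn m) true j) ?skj // (fP j jm false i) // /face_value subSS.
  congr madd; apply: cube_eval_ext => l li; first exact: shift_merge.
  by apply: shift_skip; lia.
- rewrite (fP m (ltnSn m) false j) ?skj // (fP m (ltnSn m) false i) ?ski //.
    by apply: cube_eval_ext => l _; [exact: merge_merge | exact: skip_skip].
  exact: leq_trans jm.
Qed.

End universal_cubes.

(** * Construction of the universal cubes *)

Section construction.
Variables (R : realType) (T : mappingTheory) (L : leftLinear T).
Local Notation I := (unitI R).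
Local Notation cube := (cube R).
Local Notation endpoint b := (@clamp R (b : bool)%:R%R).
Implicit Types (X A B : T).
Implicit Types Phi : forall n, level R T n.

Lemma endpointP (s : I) (b : bool) : \val s = (b%:R)%R <-> s = endpoint b.
Proof.
split=> [<-|->]; first by rewrite clampK.
by case: b; [exact: val_clamp1 | exact: val_clamp0].
Qed.

Lemma endpoint_inj (b c : bool) : endpoint b = endpoint c -> b = c.
Proof.
move/(congr1 \val); have /endpointP -> := erefl (endpoint b).
have /endpointP -> := erefl (endpoint c).
by case: b; case: c => // /eqP; rewrite ?oner_eq0 // eq_sym oner_eq0.
Qed.

Lemma bdry_bigcup (X : topologicalType) n (f : X -> cube n) :
  [set x | bdry (f x)] =
  \bigcup_(ie : 'I_n * bool) [set x | \val (f x ie.1) = (ie.2%:R)%R].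
Proof.
apply/seteqP; split => [x [i [xi|xi]]|x [[i [|]] _ xi]].
- by exists (i, false).
- by exists (i, true).
- by exists i; right.
- by exists i; left.
Qed.

(** The invariant of the induction. The wedge condition is imposed along the axes only; composition
    with [x] yields it for arbitrary [x]. *)
Definition good n Phi : Prop :=
  [/\ forall A B, continuous (Phi n A B),
      forall A B (a : mor A B) t k, mcomp (Phi n A B (a, t)) (axis A k) = a &
      match n with
      | 0 => forall A B p, Phi 0 A B p = mcomp p.1 (mproj _ ord0)
      | m.+1 => faces L Phi m
      end].

Lemma cube_eval_delta Phi n X A B (a : mor A B) k (x : nat -> mor X A) (y : mor X A)
    (t : nat -> I) :
  good n Phi -> (k <= n)%N -> (forall l, (l <= n)%N -> x l = delta k y l) ->
  cube_eval Phi n a x t = mcomp a y.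
Proof.
move=> [_ wedge _] kn xd; rewrite (cube_eval_ext _ _ xd (fun l _ => erefl)) /cube_eval.
rewrite (_ : mpair _ = mcomp (axis A (Ordinal (kn : (k < n.+1)%N))) y).
  by rewrite mcompA wedge.
apply: mpair_ext => l; rewrite mproj_mpair mcompA mproj_axis /delta -val_eqE /=.
by case: eqP; rewrite ?mcomp1m ?mcomp0m.
Qed.

Lemma cube_eval0 Phi n X A B (a : mor A B) (x : nat -> mor X A) (t : nat -> I) :
  (forall l, (l <= n)%N -> x l = mor0 X A) -> cube_eval Phi n a x t = mor0 X B.
Proof.
move=> x0; rewrite (cube_eval_ext _ _ x0 (fun l _ => erefl)) /cube_eval.
rewrite (_ : mpair _ = mor0 _ _) ?mcompm0 //.
by apply: mpair_ext => l; rewrite mproj_mpair mcompm0.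
Qed.

(** Shows that the face data agree with the wedge condition. A merge keeps the arguments on an axis;
    a splitting puts the entry [y] into one summand, and the other summand is 0. *)
Lemma face_value_delta Phi m e i X A B (a : mor A B) k (x : nat -> mor X A)
    (y : mor X A) (t : nat -> I) :
  (forall n, (n <= m)%N -> good n Phi) -> (i <= m)%N -> (k <= m.+1)%N ->
  (forall l, (l <= m.+1)%N -> x l = delta k y l) ->
  face_value L Phi m e i a x t = mcomp a y.
Proof.
move=> gP im km xd; rewrite (@face_value_ext _ _ _ _ _ _ _ _ _ _ _ x (delta k y) t t) //.
rewrite /face_value; case: e; last first.
  apply: (cube_eval_delta _ (k := if (k <= i)%N then k else k.-1)) => //.
  - exact: gP.
  - by case: ifP => ?; lia.
  - by move=> l _; rewrite merge_delta.
have [ki|ik] := leqP k i.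
  rewrite (cube_eval_delta _ (k := k) (y := y) _) //; last exact: gP.
  rewrite cube_eval0 ?maddm0 // => l _; rewrite /ishift /delta ifF //.
  by apply/negbTE; lia.
rewrite cube_eval0 ?madd0m => [|l li]; last first.
  by rewrite /delta ifF //; apply/negbTE; lia.
apply: (cube_eval_delta _ (k := (k - i.+1)%N)); first by apply: gP; exact: leq_subr.
  lia.
by move=> l _; rewrite shift_delta.
Qed.

Lemma continuous_cube_eval Phi n X A B (x : nat -> mor X A) (K : topologicalType)
    (f : K -> mor A B) (t : K -> nat -> I) :
  continuous (Phi n A B) -> continuous f -> (forall l, continuous (fun q => t q l)) ->
  continuous (fun q => cube_eval Phi n (f q) x (t q)).
Proof.
move=> cP cf ct.
apply: (continuous_compose (@continuous_mcompl _ _ _ _ _)).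
apply: (continuous_compose cP); apply: continuous_pair => //.
by apply: continuous_into_cube => i; exact: ct.
Qed.

Lemma continuous_madd (K : topologicalType) X A (f g : K -> mor X A) :
  compactly_generated K -> continuous f -> continuous g ->
  continuous (fun q => madd L (f q) (g q)).
Proof.
move=> cgK cf cg.
exact: (continuous_compose (@madd_continuous _ L X A) (continuous_kpair cgK cf cg)).
Qed.

Lemma continuous_face_value Phi m e i X A B (x : nat -> mor X A)
    (K : topologicalType) (f : K -> mor A B) (t : K -> nat -> I) :
  (forall n, (n <= m)%N -> good n Phi) -> (i <= m)%N -> compactly_generated K ->
  continuous f -> (forall l, continuous (fun q => t q l)) ->
  continuous (fun q => face_value L Phi m e i (f q) x (t q)).
Proof.
move=> gP im cgK cf ct.
have cP n : (n <= m)%N -> continuous (Phi n A B) by move=> /gP[].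
rewrite /face_value; case: e.
  apply: continuous_madd => //; apply: continuous_cube_eval => //.
  - exact: cP.
  - by apply: cP; exact: leq_subr.
  - by move=> l; exact: ct.
apply: continuous_cube_eval => // [|l]; first exact: cP.
exact: ct.
Qed.

(** The padding by 0 is arbitrary: [cube_eval] at level [n] reads only the first [n] entries. *)
Definition cube_seq n (t : cube n) (l : nat) : I :=
  if insub l is Some i then t i else clamp 0%R.

Lemma cube_seq_ord n (t : cube n) (i : 'I_n) : cube_seq t i = t i.
Proof. by rewrite /cube_seq valK. Qed.

Lemma cube_seqK n (t : nat -> I) l :
  (l < n)%N -> cube_seq ((fun i : 'I_n => t i) : cube n) l = t l.
Proof. by move=> ln; rewrite /cube_seq insubT. Qed.

Lemma continuous_cube_seq (X : topologicalType) n (f : X -> cube n) l :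
  continuous f -> continuous (fun x => cube_seq (f x) l).
Proof.
move=> cf; rewrite /cube_seq; case: insub => [i|]; last exact: continuous_cst.
exact: (continuous_cube_coord cf).
Qed.

Definition proj_seq n A (l : nat) : mor (mpower n.+1 A) A := mproj _ (inord l).

Lemma proj_seq_mpair n X A (x : nat -> mor X A) l : (l <= n)%N ->
  mcomp (proj_seq n A l) (mpair (fun i : 'I_n.+1 => x i)) = x l.
Proof. by move=> ln; rewrite mproj_mpair inordK. Qed.

Lemma faces_at Phi m : (forall n, (n <= m)%N -> good n Phi) ->
  forall n, (n < m)%N -> faces L Phi n.
Proof. by move=> gP n nm; have [_ _] := gP n.+1 nm. Qed.

Lemma face_value_unique Phi m e d i j X A B (a : mor A B)
    (x : nat -> mor X A) (t : nat -> I) :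
  (forall n, (n <= m)%N -> good n Phi) -> (i <= m)%N -> (j <= m)%N ->
  t i = endpoint e -> t j = endpoint d ->
  face_value L Phi m e i a x t = face_value L Phi m d j a x t.
Proof.
move=> gP im jm ti tj; have fP := faces_at gP.
case: (ltngtP i j) => [ij|ji|ij].
- by apply: face_value_compat => //; rewrite ij.
- by apply/esym; apply: face_value_compat => //; rewrite ji.
- by move: tj; rewrite -ij ti => /endpoint_inj ->.
Qed.

Hypothesis bilinear : weakly_bilinear R L.
Hypothesis cofibrant : forall A B, serre_cofibrant R (mor A B).

Lemma level_exists Phi m A B : (forall n, (n <= m)%N -> good n Phi) ->
  exists v : mor A B * cube m.+1 -> mor (mpower m.+2 A) B,
    [/\ continuous v, forall a t k, mcomp (v (a, t)) (axis A k) = a &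
      forall e i a (t : cube m.+1), t i = endpoint e ->
        v (a, t) = face_value L Phi m e i a (proj_seq m.+1 A) (cube_seq t)].
Proof.
move=> gP.
(* On the boundary any face containing the point may be picked, by [face_value_unique]; off the
   boundary the value 0 is a default. *)
pose F (q : mor A B * cube m.+1) : mor (mpower m.+2 A) B :=
  if [pick ie : 'I_m.+1 * bool | q.2 ie.1 == endpoint ie.2] is Some ie
  then face_value L Phi m ie.2 ie.1 q.1 (proj_seq m.+1 A) (cube_seq q.2)
  else mor0 _ _.
have FE e i q : q.2 i = endpoint e ->
    F q = face_value L Phi m e i q.1 (proj_seq m.+1 A) (cube_seq q.2).
  move=> qi; rewrite /F; case: pickP => [[j d] /= /eqP qj|/(_ (i, e))].
    by apply: face_value_unique; rewrite ?cube_seq_ord // -ltnS.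
  by rewrite /= qi eqxx.
have cgK : compactly_generated (mor A B * cube m.+1)%type.
  apply: cg_prod; [exact: cube_compact | exact: cube_hausdorff |].
  exact: (mor_cgwh _ _).1.
(* The wedge condition is the base of the lifting problem: all its components send [(a, t)] to
   [a]. *)
have [|k|k [a t] [i ti]|v [cv vF vw]] := serre_cofibrant_lifts
    (mor_cgwh _ _) (fun _ => mor_cgwh _ _) (fun k => @continuous_mcompl _ _ _ _ _)
    (axes_lifts bilinear (A := A) (B := B)) (cofibrant A B) (n := m.+1)
    (F := F) (g := fun (k : 'I_m.+2) q => q.1).
- rewrite bdry_bigcup; apply: within_bigcup_continuous => [[i e]|[i e]] /=.
    exact: (closed_val_eq (continuous_cube_coord (@continuous_snd _ _))).
  apply: (@within_eq_continuous _ _ _ (fun q =>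
      face_value L Phi m e i q.1 (proj_seq m.+1 A) (cube_seq q.2)) F).
    by move=> q /endpointP /FE.
  apply: continuous_subspaceT; apply: continuous_face_value => //.
  + by rewrite -ltnS.
  + exact: continuous_fst.
  + by move=> l; exact: (continuous_cube_seq (@continuous_snd _ _)).
- exact: continuous_fst.
- have [e te] : exists e : bool, t i = endpoint e.
    by case: ti => ti; [exists false | exists true]; apply/endpointP.
  rewrite (FE e i) // face_value_mcomp -[RHS]mcompm1.
  apply: (face_value_delta _ _ (k := k)) => //.
  + by rewrite -ltnS.
  + by rewrite -ltnS.
  move=> l lm.
  by rewrite mproj_axis /delta -val_eqE /= inordK.
- exists v; split => // e i a t ti.
  by rewrite vF ?(FE e i) //; exists i; case: e ti => /endpointP ->; [right|left].
Qed.

Lemma good_local N Phi Psi : (forall k, (k <= N)%N -> Phi k = Psi k) ->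
  good N Phi -> good N Psi.
Proof.
move=> eqP [cP wP fP]; split; rewrite -?eqP //.
case: N => [|m] in eqP {cP wP} fP *; first exact: fP.
move=> e i X A B a x t im ti.
have eqm n : (n <= m)%N -> Phi n = Psi n by move=> nm; apply: eqP; exact: leqW.
rewrite -(face_value_eq L e eqm im a x t) -(cube_eval_eq (eqP _ (leqnn _)) a x t).
exact: fP.
Qed.

Theorem good_family_exists : exists Phi, forall n, good n Phi.
Proof.
apply: (strong_dependent_choice (fun n A B p => mor0 _ _) good_local).
move=> [|m] Phi gP.
  (* Level 0 is forced by the requirement that the 0-cube at [a] and [x] is their composite. *)
  have [g [g0 _]] := update_fam Phi (N := 0)
    (fun A B p => mcomp p.1 (mproj (fun=> A) ord0)).
  exists g => //; rewrite /good g0; split => //.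
  - move=> A B; apply: (continuous_compose (@continuous_mcompl _ _ _ _ _)).
    exact: continuous_fst.
  - by move=> A B a t k; rewrite -mcompA mproj_axis !ord1 eqxx mcompm1.
have gP' n : (n <= m)%N -> good n Phi by move=> nm; exact: gP.
have vx A B := cid (level_exists A B gP').
have [g [gm gE]] := update_fam Phi (fun A B => sval (vx A B)).
have eqP n : (n <= m)%N -> Phi n = g n by move=> nm; rewrite gE.
exists g => //; split => [A B|A B a t k|e i X A B a x t im ti].
- by rewrite gm; case: (svalP (vx A B)).
- by rewrite gm; have [_ vw _] := svalP (vx A B); exact: vw.
(* The face condition at arbitrary arguments is the one at the projections, composed with the tuple
   of arguments. *)
rewrite -(face_value_eq L e eqP im) {1}/cube_eval gm.
have [_ _ vf] := svalP (vx A B); rewrite (vf e (Ordinal (im : i < m.+1)%N)) //.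
rewrite face_value_mcomp; apply: face_value_ext => // l lm.
  exact: proj_seq_mpair.
by rewrite cube_seqK.
Qed.

End construction.

(** * The good distributor given by the universal cubes *)

Section distributor_of_family.
Variables (R : realType) (T : mappingTheory) (L : leftLinear T).
Variable Phi : forall n, level R T n.
Hypothesis gP : forall n, good L n Phi.
Local Notation cube := (cube R).
Implicit Types (X A B : T).

Definition family_value n X A B (a : mor A B) (x : 'I_n.+1 -> mor X A)
    (t : cube n) : mor X B :=
  mcomp (Phi (a, t)) (mpair x).

Lemma continuous_family_value n (K : topologicalType) X A B
    (a : K -> mor A B) (x : K -> 'I_n.+1 -> mor X A) (t : K -> cube n) :
  compactly_generated K -> continuous a ->
  continuous (x : K -> kprod_fam (fun _ : 'I_n.+1 => mor X A)) -> continuous t ->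
  continuous (fun q => family_value (a q) (x q) (t q)).
Proof.
move=> cgK ca cx ct; have [cP _ _] := gP n; apply: continuous_mcomp => //.
  exact: (continuous_compose (cP A B) (continuous_pair ca ct)).
exact: (continuous_compose (@mpair_continuous _ _ (fun=> A) X) cx).
Qed.

Lemma continuous_family_cube n X A B (a : mor A B) (x : 'I_n.+1 -> mor X A) :
  continuous (family_value a x).
Proof.
apply: continuous_family_value.
- exact: cube_cg.
- exact: continuous_cst.
- exact: continuous_cst.
- exact: continuous_id.
Qed.

Definition family_dist n X A B (a : mor A B) (x : 'I_n.+1 -> mor X A) :
    continuousType (cube n) (mor X B) :=
  continuous_map (@continuous_family_cube n X A B a x).

Lemma family_distE n X A B (a : mor A B) (x : 'I_n.+1 -> mor X A) t :
  family_dist a x t = mcomp (Phi (a, t)) (mpair x).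
Proof. by []. Qed.

Lemma family_dist_eval n X A B (a : mor A B) (x : 'I_n.+1 -> mor X A) t :
  family_dist a x t =
  cube_eval Phi n a (fun l => x (inord l)) (cube_seq t).
Proof.
rewrite family_distE /cube_eval; congr (mcomp (Phi (a, _)) (mpair _)).
  by apply: funext => i; rewrite cube_seq_ord.
by apply: functional_extensionality_dep => i; rewrite inord_val.
Qed.

(** Continuity into the mapping space is adjoint to joint continuity on [K * cube n], which is
    compactly generated, so that composition is continuous there. *)
Lemma family_continuous n X A B :
  continuous
    (fun p : kprod (mor A B) (kprod_fam (fun _ : 'I_n.+1 => mor X A)) =>
       family_dist p.1 p.2 : map_space (cube n) (mor X B)).
Proof.
pose K := kprod (mor A B) (kprod_fam (fun _ : 'I_n.+1 => mor X A)).
have cgK : compactly_generated K := @kify_cg _.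
have cfst := @continuous_fst K (cube n).
apply: continuous_into_map_space => //.
have : continuous (fun q : K * cube n => family_value q.1.1 q.1.2 q.2).
  apply: continuous_family_value.
  - by apply: cg_prod => //; [exact: cube_compact | exact: cube_hausdorff].
  - exact: (continuous_compose (@continuous_kfst _ _) cfst).
  - exact: (continuous_compose (@continuous_ksnd _ _) cfst).
  - exact: continuous_snd.
exact.
Qed.

Lemma family_dist0 X A B (a : mor A B) (x : 'I_1 -> mor X A) (t : cube 0) :
  family_dist a x t = mcomp a (x ord0).
Proof. by rewrite family_distE; have [_ _ ->] := gP 0; rewrite -mcompA mproj_mpair. Qed.

Lemma family_face0 n X A B (a : mor A B) (x : 'I_n.+2 -> mor X A)
    (i : 'I_n.+1) (t : cube n.+1) :
  \val (t i) = 0%R ->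
  family_dist a x t = family_dist a (merge_args L i x) (fun l : 'I_n => t (lift i l)).
Proof.
move=> ti; have [_ _ fP] := gP n.+1; rewrite !family_dist_eval.
rewrite (fP false i) ?cube_seq_ord //; [|by rewrite -ltnS|exact: unitI_eq0].
apply: cube_eval_ext => l ln; last first.
  by rewrite (cube_seq_ord _ (Ordinal ln)) -(cube_seq_ord t).
rewrite /merge_args /imerge -val_eqE /= inordK //.
case: (ltngtP l i) => // [li|il]; congr x; apply: val_inj.
  by rewrite /= !inordK ?ltnS ?(leq_trans ln) //; rewrite /bump; lia.
by rewrite /= !inordK //; rewrite /bump; lia.
Qed.

Lemma family_face1 n X A B (a : mor A B) (x : 'I_n.+2 -> mor X A)
    (i : 'I_n.+1) (t : cube n.+1) :
  \val (t i) = 1%R ->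
  family_dist a x t =
    madd L
      (family_dist a (fun l : 'I_i.+1 => x (inord l))
              (fun l : 'I_i => t (inord l)))
      (family_dist a (fun l : 'I_(n - i).+1 => x (inord (i.+1 + l)))
              (fun l : 'I_(n - i) => t (inord (i.+1 + l)))).
Proof.
move=> ti; have [_ _ fP] := gP n.+1; rewrite !family_dist_eval.
rewrite (fP true i) ?cube_seq_ord //; [|by rewrite -ltnS|exact: unitI_eq1].
have lti := ltn_ord i.
congr madd; apply: cube_eval_ext => l li.
- by congr x; apply: val_inj; rewrite /= !inordK //; lia.
- rewrite (cube_seq_ord _ (Ordinal li)) -(cube_seq_ord t) inordK //=; lia.
- by rewrite /ishift !inordK.
- by rewrite /ishift (cube_seq_ord _ (Ordinal li)) -(cube_seq_ord t) inordK //=; lia.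
Qed.

Definition family_distributor : distributor R L :=
  Distributor family_continuous family_dist0 family_face0 family_face1.

Lemma family_distributor_good : good_distributor family_distributor.
Proof.
move=> n; split=> [X A B a x|X A B a x k]; apply: funext => t.
  transitivity (mcomp (mcomp (Phi (a, t)) (mpair (mproj (fun _ : 'I_n.+1 => A))))
    (mpair x)) => //.
  rewrite -mcompA mpair_mcomp; congr (mcomp _ (mpair _)).
  by apply: functional_extensionality_dep => j; rewrite mproj_mpair.
transitivity (family_dist a (fun l => if l == k then x else mor0 X A) t) => //.
rewrite family_dist_eval; apply: (cube_eval_delta _ (k := k)); first exact: gP.
  by rewrite -ltnS.
by move=> l ln; rewrite /delta -val_eqE /= inordK.
Qed.

End distributor_of_family.

Theorem theorem5p10 (R : realType) (T : mappingTheory) (L : leftLinear T)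
    (weakly_bilinear_T : weakly_bilinear R L)
    (cofibrant_T : forall A B : T, serre_cofibrant R (mor A B)) :
  exists phi : distributor R L, good_distributor phi.
Proof.
have [Phi gP] := good_family_exists weakly_bilinear_T cofibrant_T.
by exists (family_distributor gP); exact: family_distributor_good.
Qed.
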